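(* Let $K=\mathbb{F}_q$ be a finite field and let $\mathbb{X}$ be the set in $\mathbb{P}^{s-1}$ parameterized by a set of monomials $y^{v_1},\ldots,y^{v_s}$ of $K[y_1,\ldots,y_n]$ such that $\mathrm{supp}(y^{v_i})\not\subset\mathrm{supp}(y^{v_j})$ for any $i\neq j$. Let $I(\mathbb{X})\subset S=K[t_1,\ldots,t_s]$ be the vanishing ideal of $\mathbb{X}$. Then $I(\mathbb{X})$ is a complete intersection if and only if $s\leq 4$ and, up to permutation of the variables $t_1,\ldots,t_s$, $I=I(\mathbb{X})$ has one of the following forms: (i) $s=4$, $q$ is odd and $I=(t_1t_2-t_3t_4,\ t_1t_3-t_2t_4,\ t_2t_3-t_1t_4)$. (ii) $s=3$ and $I=(t_1t_2-t_2t_3,\ t_1t_3-t_2t_3)$. (iii) $s=2$ and $I=(t_1^{r+1}t_2-t_1t_2^{r+1})$, where $0\neq r\in\mathbb{N}$ is a divisor of $q-1$. (iv) $s=1$ and $I=(0)$.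
   Context: $K=\mathbb{F}_q$ is the finite field with $q$ elements. For $v_i=(v_{i1},\ldots,v_{in})\in\mathbb{N}^n$ (with $0\in\mathbb{N}$), $y^{v_i}=y_1^{v_{i1}}\cdots y_n^{v_{in}}$ is a monomial in $K[y_1,\ldots,y_n]$, and its support $\mathrm{supp}(y^{v_i})$ is the set of variables $y_k$ with $v_{ik}>0$. The symbol $\not\subset$ means ''is not a subset of (possibly equal)''. Points of the projective space $\mathbb{P}^{s-1}$ over $K$ are written $[\alpha]$ with $0\neq\alpha\in K^s$. The set $\mathbb{X}\subset\mathbb{P}^{s-1}$ parameterized by $y^{v_1},\ldots,y^{v_s}$ consists of all points $[(x^{v_1},\ldots,x^{v_s})]$ that are well defined, i.e. with $x\in K^n$ and $x^{v_i}\neq 0$ for some $i$ (where $x^{v_i}$ is $y^{v_i}$ evaluated at $x$). $S=K[t_1,\ldots,t_s]$ has the standard grading, and the vanishing ideal $I(\mathbb{X})$ is the graded ideal of $S$ generated by the homogeneous polynomials of $S$ that vanish at all points of $\mathbb{X}$; its height is $s-1$. An ideal $I\subset S$ is a complete intersection if there exist $g_1,\ldots,g_r\in S$ with $I=(g_1,\ldots,g_r)$, where $r$ is the height of $I$. For the graded ideal $I(\mathbb{X})$ this means that it is generated by $s-1$ homogeneous polynomials. *)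

(* Defs.v *)
From HB Require Import structures.
From mathcomp Require Import all_boot all_order all_fingroup all_algebra.
From mathcomp Require Export mpoly.

Set Implicit Arguments.
Unset Strict Implicit.
Unset Printing Implicit Defensive.

Import GRing.Theory.
Local Open Scope ring_scope.

(* Ideals obtained by generation are Prop-valued, since membership in them is
   not decidable in general; prime ideals use the boolean notions of
   ring_quotient, which is classically no restriction. *)
Section Ideals.
Variable R : comNzRingType.
Implicit Types (I J G : R -> Prop) (P : {pred R}).

Definition eq_ideal I J : Prop := forall f, I f <-> J f.

Definition ideal_gen G : R -> Prop := fun f =>
  exists (k : nat) (h g : 'I_k -> R),
    (forall i, G (g i)) /\ f = \sum_(i < k) h i * g i.

Definition ideal_of_seq (gs : seq R) : R -> Prop :=
  ideal_gen (fun g => g \in gs).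

(* [idealr_closed] already contains [1 \notin P]. *)
Definition prime_ideal P : Prop := idealr_closed P /\ prime_idealr_closed P.

Definition prime_chain (C : nat -> {pred R}) (l : nat) : Prop :=
  (forall i, (i <= l)%N -> prime_ideal (C i)) /\
  (forall i, (i < l)%N ->
     {subset C i <= C i.+1} /\ ~ {subset C i.+1 <= C i}).

Definition chain_below P (l : nat) : Prop :=
  exists C, prime_chain C l /\ C l =i P.

Definition prime_height P (h : nat) : Prop :=
  chain_below P h /\ (forall l, chain_below P l -> (l <= h)%N).

Definition prime_over I P : Prop :=
  prime_ideal P /\ (forall f, I f -> f \in P).

(* Minimum of the heights of the primes containing I. Primes of infinite
   height have no [prime_height] and do not affect a finite minimum. *)
Definition ideal_height I (r : nat) : Prop :=
  (exists P, prime_over I P /\ prime_height P r) /\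
  (forall P h, prime_over I P -> prime_height P h -> (r <= h)%N).

Definition complete_intersection I : Prop :=
  exists gs : seq R, ideal_height I (size gs) /\ eq_ideal I (ideal_of_seq gs).

End Ideals.

Definition mon_supp (n : nat) (m : 'X_{1..n}) : {set 'I_n} :=
  [set k | (0 < m k)%N].

Section Parameterized.
Variables (K : finFieldType) (n s : nat) (v : 'I_s -> 'X_{1..n}).

(* A point [a] of projective space is the set of all its homogeneous
   coordinate vectors. *)
Definition proj_point (a : 'rV[K]_s) : {set 'rV[K]_s} :=
  [set c *: a | c in [pred c : K | c != 0]].

Definition mon_eval (x : 'rV[K]_n) : 'rV[K]_s :=
  \row_(i < s) ('X_[v i] : {mpoly K[n]}).@[x 0].

Definition param_set : {set {set 'rV[K]_s}} :=
  [set proj_point (mon_eval x) | x in [pred x | mon_eval x != 0]].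

End Parameterized.

Section Vanishing.
Variables (K : finFieldType) (s : nat) (X : {set {set 'rV[K]_s}}).

Definition homogeneous (f : {mpoly K[s]}) : Prop :=
  exists d : nat, f \is d.-homog.

Definition vanishes (f : {mpoly K[s]}) : Prop :=
  forall p, p \in X -> forall a : 'rV[K]_s, a \in p -> f.@[a 0] = 0.

Definition vanishing_ideal : {mpoly K[s]} -> Prop :=
  ideal_gen (fun f => homogeneous f /\ vanishes f).

End Vanishing.

(* The k-th variable after renaming by sigma, with k counted from 1; it is only
   meaningful for 1 <= k <= s. *)
Definition perm_var (K : finFieldType) (s : nat) (sigma : 'S_s) (k : nat) :
    {mpoly K[s]} :=
  [seq 'X_(sigma i) | i <- enum 'I_s]`_k.-1.

(* Main.v *)
Require Import Defs.
From HB Require Import structures.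
From mathcomp Require Import all_boot all_order all_fingroup all_algebra.
From mathcomp Require Import finfield zify ring.
From Stdlib Require Import Classical_Prop.

(** Write I for the vanishing ideal and s = n + 1 for the number of coordinates.

    The height of I is n ([height_vanishing_ideal]). The ideal of a point has
    height n because the polynomial ring has dimension n + 1
    ([prime_chain_le]), and every prime containing I contains the ideal of a
    point. Hence any of the four listed forms, which has n generators, is a
    complete intersection (the zero ideal being generated by the empty list).

    Conversely let I be generated by at most n polynomials. Three facts
    determine the generators.

    - I is generated by homogeneous binomials ([vanishing_ideal_binomial]):
      monomials in the parameterized coordinates are multiplicative characters
      in the parameters, and distinct characters are linearly independent. By
      graded Nakayama ([drop_generator]) at most n of these binomials suffice.

    - The antichain condition on the supports puts every coordinate point
      e_i in the set ([vanishes_unit_point]), so no generator contains a pure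
      power of a variable.

    - The polynomials t_i^q t_j - t_i t_j^q belong to I, and for fixed i their
      differentials at e_i are linearly independent. So the differentials at
      e_i of the at most n generators are linearly independent as well, and in
      particular nonzero ([tangent_neq0]).

    A monomial of degree d with a nonzero derivative at e_i in the direction of
    t_j is t_i^(d-1) t_j ([tangent_mnmE]). Thus the two monomials of a generator
    have to serve all n + 1 coordinate points, while a monomial serves one point
    if d > 2 and two points if d = 2. This gives s <= 4
    ([at_most_four_variables]), d = 2 when s >= 3 ([generator_quadratic]), and
    then the explicit forms ([four_ideal], [three_ideal], [two_ideal]). The
    parity of q for s = 4 comes from the fact that the three quadrics do not
    define a reduced scheme at [1 : 1 : 1 : 1] in characteristic 2
    ([four_relations_odd]). *)

Set Implicit Arguments.
Unset Strict Implicit.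
Unset Printing Implicit Defensive.

Import GRing.Theory.
Local Open Scope ring_scope.

(** * Ideals and their generators *)

Section IdealGeneration.
Variable R : comNzRingType.
Implicit Types (G J : R -> Prop) (gs : seq R).

Definition is_ideal J : Prop :=
  [/\ J 0, forall f g, J f -> J g -> J (f + g) & forall h f, J f -> J (h * f)].

Lemma is_ideal_sum J (T : Type) (r : seq T) (P : pred T) (F : T -> R) :
  is_ideal J -> (forall i, P i -> J (F i)) -> J (\sum_(i <- r | P i) F i).
Proof. by case=> J0 JD _ JF; elim/big_ind: _. Qed.

Lemma is_idealN J f : is_ideal J -> J f -> J (- f).
Proof. by case=> _ _ JM Jf; rewrite -mulN1r; apply: JM. Qed.

Lemma is_idealB J f g : is_ideal J -> J f -> J g -> J (f - g).
Proof. by move=> iJ Jf Jg; case: (iJ) => _ JD _; apply: JD => //; apply: is_idealN. Qed.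

Lemma ideal_gen_min G J f :
  is_ideal J -> (forall g, G g -> J g) -> ideal_gen G f -> J f.
Proof.
move=> iJ GJ [k [h [g [Gg ->]]]]; apply: is_ideal_sum => // i _.
by case: iJ => _ _; apply; apply: GJ.
Qed.

Lemma ideal_gen_is_ideal G : is_ideal (ideal_gen G).
Proof.
split.
- by exists 0%N, (fun=> 0), (fun=> 0); split=> [[]|] //; rewrite big_ord0.
- move=> _ _ [k [h [g [Gg ->]]]] [k' [h' [g' [Gg' ->]]]].
  pose pick T (a : 'I_k -> T) (b : 'I_k' -> T) i :=
    match split i with inl j => a j | inr j => b j end.
  exists (k + k')%N, (pick _ h h'), (pick _ g g'); split.
    by move=> i; rewrite /pick; case: split.
  rewrite big_split_ord /=; congr (_ + _); apply: eq_bigr => i _; rewrite /pick.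
    by rewrite -[lshift _ i]/(unsplit (inl i)) unsplitK.
  by rewrite -[rshift _ i]/(unsplit (inr i)) unsplitK.
- move=> a _ [k [h [g [Gg ->]]]]; exists k, (fun i => a * h i), g; split=> //.
  by rewrite mulr_sumr; apply: eq_bigr => i _; rewrite mulrA.
Qed.

Lemma mem_ideal_gen G g : G g -> ideal_gen G g.
Proof.
move=> Gg; exists 1%N, (fun=> 1), (fun=> g); split=> //.
by rewrite big_ord1 mul1r.
Qed.

Lemma ideal_of_seqP gs f :
  ideal_of_seq gs f <->
  exists h : 'I_(size gs) -> R, f = \sum_i h i * gs`_i.
Proof.
split; last first.
  case=> h ->; apply: is_ideal_sum => [|i _]; first exact: ideal_gen_is_ideal.
  have [_ _] := ideal_gen_is_ideal (fun g => g \in gs); apply.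
  by apply: mem_ideal_gen; rewrite mem_nth.
pose J f := exists h : 'I_(size gs) -> R, f = \sum_i h i * gs`_i.
apply: (@ideal_gen_min _ J) => [|g g_gs].
  split.
  - by exists (fun=> 0); rewrite big1 // => i _; rewrite mul0r.
  - move=> _ _ [h ->] [h' ->]; exists (fun i => h i + h' i).
    by rewrite -big_split; apply: eq_bigr => i _; rewrite mulrDl.
  - move=> a _ [h ->]; exists (fun i => a * h i).
    by rewrite mulr_sumr; apply: eq_bigr => i _; rewrite mulrA.
have lt_g : (index g gs < size gs)%N by rewrite index_mem.
exists (fun i => (i == Ordinal lt_g)%:R).
rewrite (bigD1 (Ordinal lt_g)) //= eqxx mul1r nth_index // big1 ?addr0 // => i.
by move/negPf->; rewrite mul0r.
Qed.

Lemma ideal_of_seq_sub (gs gs' : seq R) f :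
  (forall g, g \in gs -> ideal_of_seq gs' g) ->
  ideal_of_seq gs f -> ideal_of_seq gs' f.
Proof. by apply: ideal_gen_min; apply: ideal_gen_is_ideal. Qed.

(** Each membership involves finitely many elements of [G], so an ideal with a
    finite generating family has one inside any other generating set. *)
Lemma ideal_gen_finite G gs :
  (forall g, g \in gs -> ideal_gen G g) ->
  exists B : seq R, (forall b, b \in B -> G b) /\
                    (forall g, g \in gs -> ideal_of_seq B g).
Proof.
elim: gs => [|g gs IH] Ggs; first by exists [::].
have [B [GB gsB]] := IH (fun f fgs => Ggs f (mem_behead (s := g :: gs) fgs)).
have [k [h [b [Gb Dg]]]] := Ggs g (mem_head _ _).
exists ([seq b i | i <- enum 'I_k] ++ B); split=> [f|f].
  by rewrite mem_cat => /orP[/mapP[i _ ->]|/GB].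
have subB : forall x, x \in B -> ideal_of_seq ([seq b i | i <- enum 'I_k] ++ B) x.
  by move=> x xB; apply: mem_ideal_gen; rewrite mem_cat xB orbT.
rewrite inE => /orP[/eqP->|/gsB]; last exact: ideal_of_seq_sub.
rewrite Dg; apply: is_ideal_sum => [|i _]; first exact: ideal_gen_is_ideal.
have [_ _] := ideal_gen_is_ideal (fun g => g \in [seq b i | i <- enum 'I_k] ++ B).
apply; apply: mem_ideal_gen; rewrite mem_cat map_f //.
by rewrite mem_enum.
Qed.

End IdealGeneration.

Section PrimeIdeals.
Variable R : comNzRingType.
Implicit Types P Q : {pred R}.

Lemma prime_is_ideal P : prime_ideal P -> is_ideal (fun f => f \in P).
Proof.
move=> [[P0 _ PM] _]; split=> // [f g fP gP|h f fP].
  by rewrite -[f]mul1r PM.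
by rewrite -[_ * f]addr0 PM.
Qed.

Lemma primeM P f g : prime_ideal P -> f * g \in P -> (f \in P) || (g \in P).
Proof. by case=> _; apply. Qed.

Lemma prime1 P : prime_ideal P -> 1 \notin P.
Proof. by case=> [[]]. Qed.

Lemma primeX P f k : prime_ideal P -> f \notin P -> f ^+ k \notin P.
Proof.
move=> pP fP; elim: k => [|k IH]; first by rewrite expr0 prime1.
by rewrite exprS; apply/negP => /(primeM pP); rewrite (negPf fP) (negPf IH).
Qed.

Lemma prime_prod P (T : Type) (r : seq T) (F : T -> R) :
  prime_ideal P -> \prod_(i <- r) F i \in P -> has (fun i => F i \in P) r.
Proof.
move=> pP; elim: r => [|x r IH]; first by rewrite big_nil (negPf (prime1 pP)).
by rewrite big_cons => /(primeM pP)/orP[xP|/IH rP]; apply/orP; [left|right].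
Qed.
End PrimeIdeals.

Section PrimeKernels.
Variables (R : comNzRingType) (D : idomainType) (f : {rmorphism R -> D}).
Lemma prime_ker : prime_ideal [pred x | f x == 0].
Proof.
split; last by move=> x y; rewrite !inE rmorphM mulf_eq0.
split; rewrite ?inE ?rmorph0 ?rmorph1 ?oner_neq0 // => a x y.
by rewrite !inE rmorphD rmorphM => /eqP-> /eqP->; rewrite mulr0 addr0.
Qed.
End PrimeKernels.

(** * Krull dimension of a polynomial ring *)

Section Dimension.
Variables (K : finFieldType) (s : nat).
Local Notation S := {mpoly K[s]}.

Section Nested.
Variable N : nat.

(** The polynomial in [xs] with coefficients [c], each exponent being less than
    [N], written in Horner-like nested form: the first element of [xs] is the
    outermost variable, and [c] receives the list of exponents. The nesting
    follows the chain of primes in [nested_eq0_coef]. *)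
Fixpoint nested (xs : seq S) (c : seq 'I_N -> K) : S :=
  if xs is x :: xs' then \sum_(j < N) x ^+ j * nested xs' (fun e => c (j :: e))
  else (c [::])%:MP.

Lemma nestedB xs c d :
  nested xs (fun e => c e - d e) = nested xs c - nested xs d.
Proof.
elim: xs c d => [|x xs IH] c d /=; first by rewrite mpolyCB.
by rewrite -sumrB; apply: eq_bigr => j _; rewrite IH mulrBr.
Qed.

Lemma nested0 xs c : (forall e, size e = size xs -> c e = 0) -> nested xs c = 0.
Proof.
elim: xs c => [|x xs IH] c c0 /=; first by rewrite c0.
by rewrite big1 // => j _; rewrite IH ?mulr0 // => e sze; rewrite c0 //= sze.
Qed.

(** If each [xs`_i] separates two consecutive primes of a chain, then the
    elements of [xs] are algebraically independent modulo the bottom prime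
    (the Coquand-Lombardi argument). Dividing out the lowest power of the first
    element [x] leaves [c_j + x * r] in the bottom prime, because [x] is not in
    it; as [x] lies in the next prime, so does [c_j], and the induction
    continues one step up the chain. *)
Lemma nested_eq0_coef (xs : seq S) (C : nat -> {pred S}) (c : seq 'I_N -> K) :
  (forall i, (i <= size xs)%N -> prime_ideal (C i)) ->
  (forall i, (i < size xs)%N ->
     [/\ {subset C i <= C i.+1}, xs`_i \in C i.+1 & xs`_i \notin C i]) ->
  nested xs c \in C 0%N -> forall e, size e = size xs -> c e = 0.
Proof.
elim: xs C c => [|x xs IH] C c pC chC /=.
  move=> c0 e /size0nil ->; apply/eqP; apply: contraTT c0 => c0.
  apply/negP => cC; case/negP: (prime1 (pC 0%N isT)).
  have [_ _ /(_ (c [::])^-1%:MP _ cC)] := prime_is_ideal (pC 0%N isT).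
  by rewrite -mpolyCM mulVf.
have [sub01 xC1 xC0] := chC 0%N isT; rewrite /= in xC1 xC0.
have iC0 := prime_is_ideal (pC 0%N isT).
have iC1 := prime_is_ideal (pC 1%N isT).
move=> cC [//|j e] [szj].
(* Induct on j: coefficients below j vanish, so x ^+ j factors out. *)
elim/ltn_ind: {j}(nat_of_ord j) {-2}j (erefl (nat_of_ord j)) e szj => m IHm j Dm e sze.
apply: (IH (fun i => C i.+1) (fun e => c (j :: e))) => //.
- by move=> i ltis; apply: pC.
- by move=> i ltis; apply: (chC i.+1).
pose r := \sum_(i < N | (j < i)%N) x ^+ (i - j).-1 * nested xs (fun e => c (i :: e)).
have Dc : \sum_(i < N) x ^+ i * nested xs (fun e => c (i :: e)) =
          x ^+ j * (nested xs (fun e => c (j :: e)) + x * r).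
  rewrite (bigD1 j) //= mulrDr; congr (_ + _).
  rewrite mulrA -exprSr mulr_sumr big_mkcond [RHS]big_mkcond /=.
  apply: eq_bigr => i _; rewrite -val_eqE /=; case: ltngtP => //= [ltji|ltij].
    by rewrite mulrA -exprD; congr (_ ^+ _ * _); lia.
  suff ->: nested xs (fun e => c (i :: e)) = 0 by rewrite mulr0.
  have {}IHm e' : size e' = size xs -> c (i :: e') = 0.
    by apply: (IHm i) => //; rewrite -Dm.
  exact: nested0.
move: cC; rewrite Dc => /(primeM (pC 0%N isT)).
rewrite (negPf (primeX _ (pC 0%N isT) xC0)) /= => /sub01 inC1.
have := is_idealB iC1 inC1 (_ : x * r \in C 1%N); rewrite addrK; apply.
by rewrite mulrC; case: iC1 => _ _; apply.
Qed.

Lemma msizeM_pred (p q : S) : (msize (p * q) <= (msize p + msize q).-1)%N.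
Proof.
have [->|p0] := eqVneq p 0; first by rewrite mul0r msize0.
have [->|q0] := eqVneq q 0; first by rewrite mulr0 msize0.
by rewrite msizeM.
Qed.

Lemma msize_nested E xs c :
  (forall x, x \in xs -> (msize x <= E.+1)%N) ->
  (msize (nested xs c) <= (size xs * (N * E)).+1)%N.
Proof.
elim: xs c => [|x xs IH] c leE /=; first by rewrite msizeC; case: (_ == _).
apply: (leq_trans (msize_sum _ _ _)); apply/bigmax_leqP => j _.
have le_x : (msize (x ^+ j) <= (j * E).+1)%N.
  elim: {j}(nat_of_ord j) => [|j IHj]; first by rewrite expr0 msize1.
  rewrite exprS (leq_trans (msizeM_pred _ _)) //.
  by have := leE x (mem_head _ _); move: IHj; rewrite mulSn; lia.
have le_n : (msize (nested xs (fun e => c (j :: e))) <= (size xs * (N * E)).+1)%N.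
  by apply: IH => y yxs; apply: leE; rewrite inE yxs orbT.
rewrite (leq_trans (msizeM_pred _ _)) //.
have : (j * E <= N * E)%N by rewrite leq_mul2r ltnW ?orbT.
move: le_x le_n; rewrite mulSn.
case: (msize (x ^+ j)) => [|p]; case: (msize _) => [|p'] //=; last by lia.
  by lia.
by lia.
Qed.

End Nested.

Lemma card_bmnm D : (#|{: 'X_{1..s < D.+1}}| <= D.+1 ^ s)%N.
Proof.
pose F (m : 'X_{1..s < D.+1}) : {ffun 'I_s -> 'I_D.+1} :=
  [ffun i => inord ((m : 'X_{1..s}) i)].
have Finj : injective F.
  have bnd (m : 'X_{1..s < D.+1}) i : ((m : 'X_{1..s}) i < D.+1)%N.
    apply: leq_ltn_trans (bmdeg m); rewrite mdegE (bigD1 i) //=.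
    exact: leq_addr.
  move=> m1 m2 /ffunP eqF; apply/eqP; rewrite bmeqP; apply/eqP/mnmP => i.
  by have := congr1 val (eqF i); rewrite !ffunE /= !inordK.
by have := leq_card F Finj; rewrite card_ffun !card_ord.
Qed.

(** A family that is algebraically independent up to exponent [N] makes
    evaluation of coefficient families injective, so over a finite field their
    number is bounded by the number of polynomials of degree at most [D]. *)
Lemma card_alg_indep (D N : nat) (xs : seq S) :
  (forall c : seq 'I_N -> K, (msize (nested xs c) <= D.+1)%N) ->
  (forall c : seq 'I_N -> K, nested xs c = 0 ->
     forall e, size e = size xs -> c e = 0) ->
  (N ^ size xs <= D.+1 ^ s)%N.
Proof.
move=> leD indep.
pose fn (c : {ffun (size xs).-tuple 'I_N -> K}) (e : seq 'I_N) :=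
  if insub e is Some t then c t else 0.
pose F c : {ffun 'X_{1..s < D.+1} -> K} :=
  [ffun m : 'X_{1..s < D.+1} => (nested xs (fn c))@_m].
have Finj : injective F.
  move=> c d /ffunP eqF; apply/ffunP => t.
  have eq_n : nested xs (fun e => fn c e - fn d e) = 0.
    rewrite nestedB; apply/eqP; rewrite subr_eq0; apply/eqP/mpolyP => m.
    have [ltm|lem] := ltnP (mdeg m) D.+1.
      by have := eqF (BMultinom ltm); rewrite !ffunE.
    by rewrite !memN_msupp_eq0 // msize_mdeg_ge // (leq_trans (leD _)).
  have := indep _ eq_n t (size_tuple t); rewrite /fn valK => /eqP.
  by rewrite subr_eq0 => /eqP.
have := leq_card F Finj; rewrite !card_ffun card_tuple card_ord.
rewrite leq_exp2l; last exact: card_finNzRing_gt1.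
by move/leq_trans; apply; apply: card_bmnm.
Qed.

(** A longer chain would give [s + 1] algebraically independent polynomials.
    Their monomials with exponents below [N] number [N ^ (s + 1)] and have degree
    linear in [N], which exceeds the [O (N ^ s)] monomials available. *)
Theorem prime_chain_le (C : nat -> {pred S}) l : prime_chain C l -> (l <= s)%N.
Proof.
case=> pC ltC; rewrite leqNgt; apply/negP => lt_sl.
have /fin_all_exists[x xC] (i : 'I_s.+1) : exists x, x \in C i.+1 /\ x \notin C i.
  have [_ ncC] := ltC i (leq_trans (ltn_ord i) lt_sl).
  apply: NNPP => nex; case: ncC => y yC; apply: contraT => yC'.
  by case: nex; exists y.
pose xs := [seq x i | i <- enum 'I_s.+1].
have sz_xs : size xs = s.+1 by rewrite size_map size_enum_ord.
have nth_xs i (lti : (i < s.+1)%N) : xs`_i = x (Ordinal lti).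
  rewrite (nth_map (Ordinal lti)) ?size_enum_ord //; congr x.
  by apply: val_inj; rewrite /= nth_enum_ord.
pose E := \max_(y <- xs) msize y.
(* N satisfies (s.+1 * (N * E)).+1 ^ s <= N ^ s * (s.+1 * E).+1 ^ s < N ^ s.+1. *)
pose N := ((s.+1 * E).+1 ^ s).+1.
have indep (c : seq 'I_N -> K) : nested xs c = 0 ->
     forall e, size e = size xs -> c e = 0.
  move=> c0; apply: (nested_eq0_coef (C := C)) => [i|i|].
  - by rewrite sz_xs => lei; apply: pC; apply: leq_trans lt_sl.
  - rewrite sz_xs => lti; rewrite (nth_xs i lti).
    have [xC1 xC0] := xC (Ordinal lti); split=> //.
    by have [] := ltC i (leq_trans lti lt_sl).
  - by rewrite c0; have [] := prime_is_ideal (pC 0%N isT).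
have leE (c : seq 'I_N -> K) : (msize (nested xs c) <= (s.+1 * (N * E)).+1)%N.
  rewrite -sz_xs; apply: msize_nested => y yxs; apply: leqW.
  by rewrite /E; apply: (leq_bigmax_seq (F := fun y : S => msize y)).
have := card_alg_indep leE indep; rewrite sz_xs leqNgt => /negP; apply.
apply: (@leq_ltn_trans ((N * (s.+1 * E).+1) ^ s)%N).
  have [->|s0] := posnP s; first by rewrite !expn0.
  have : (0 < N)%N by [].
  by rewrite leq_exp2r //; move: (N) => N'; nia.
by rewrite expnMn expnS mulnC ltn_mul2r expn_gt0 /= /N ltnS leqnn.
Qed.
End Dimension.

(** * The height of a vanishing ideal *)

Lemma eq_mpoly_morph (K : fieldType) (n : nat) (D : comNzRingType)
    (phi psi : {rmorphism {mpoly K[n]} -> D}) :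
  (forall c, phi c%:MP = psi c%:MP) -> (forall i, phi 'X_i = psi 'X_i) ->
  phi =1 psi.
Proof.
move=> eqC eqX f; rewrite [f]mpolyE !rmorph_sum /=; apply: eq_bigr => m _.
rewrite -mul_mpolyC mpolyXE_id !rmorphM eqC !rmorph_prod /=; congr (_ * _).
by apply: eq_bigr => i _; rewrite !rmorphXn eqX.
Qed.

Section LineEvaluation.
Variables (K : fieldType) (n : nat).
Implicit Types (a : 'I_n -> K) (f : {mpoly K[n]}).

(** Restriction of a polynomial to the line through the origin and [a]; its
    coefficients are the values at [a] of the homogeneous components
    ([coef_line_eval]), so its kernel is the homogeneous ideal of the point
    [a] of projective space. *)
Definition line_eval a f : {poly K} := mmap polyC (fun i => a i *: 'X) f.

HB.instance Definition _ a := GRing.RMorphism.copy (line_eval a)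
  (mmap (polyC : {rmorphism K -> {poly K}}) (fun i => a i *: 'X)).

Lemma line_evalC a c : line_eval a c%:MP = c%:P.
Proof. exact: mmapC. Qed.

Lemma line_evalU a i : line_eval a 'X_i = a i *: 'X.
Proof. by rewrite /line_eval mmapX mmap1U. Qed.

Lemma line_evalX a m :
  line_eval a 'X_[m] = ('X_[m] : {mpoly K[n]}).@[a] *: 'X^(mdeg m).
Proof.
rewrite /line_eval mmapX /mmap1 mevalX mdegE -prodrXr -scaler_prod.
by apply: eq_bigr => i _; rewrite exprZn.
Qed.

Lemma coef_line_eval a f d : (line_eval a f)`_d = (pihomog mdeg d f).@[a].
Proof.
rewrite pihomogE [in LHS](mpolyE f) !rmorph_sum /= coef_sum big_mkcond /=.
rewrite big_seq [RHS]big_mkcond [RHS]big_seq; apply: eq_bigr => m _.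
rewrite -mul_mpolyC rmorphM /= line_evalC line_evalX coefCM coefZ coefXn eq_sym.
by case: eqP => _; rewrite ?mulr0 // mulr1 mevalM mevalC.
Qed.

Lemma line_eval_homog a f d :
  f \is d.-homog -> line_eval a f = f.@[a] *: 'X^d.
Proof.
move=> hf; apply/polyP => e; rewrite coef_line_eval coefZ coefXn.
have [->|ned] := eqVneq e d; first by rewrite pihomog_dE ?mulr1.
by rewrite (pihomog_ne0 _ hf) 1?eq_sym // meval0 mulr0.
Qed.

Lemma meval_homog_scale a c f d :
  f \is d.-homog -> f.@[fun i => c * a i] = c ^+ d * f.@[a].
Proof.
move=> /dhomogP hf; rewrite !mevalE mulr_sumr big_seq [RHS]big_seq.
apply: eq_bigr => m /hf Dm; have {Dm}<- : mdeg m = d := Dm; rewrite mdegE.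
rewrite mulrCA -prodrXr -big_split /=.
by congr (_ * _); apply: eq_bigr => i _; rewrite exprMn.
Qed.

Lemma line_eval_scale_eq0 a c f :
  line_eval a f = 0 -> line_eval (fun i => c * a i) f = 0.
Proof.
move=> f0; apply/polyP => d; rewrite coef_line_eval.
by rewrite (meval_homog_scale _ _ (pihomogP _ _ _)) -coef_line_eval f0 coef0 mulr0.
Qed.

End LineEvaluation.

Section VanishingIdeal.
Variables (K : finFieldType) (s : nat) (X : {set {set 'rV[K]_s}}).

(** The vanishing ideal is the intersection of the ideals of its points: a
    polynomial that restricts to zero on every line has all of its homogeneous
    components vanishing on [X]. *)
Lemma vanishing_idealP (f : {mpoly K[s]}) :
  vanishing_ideal X f <->
  forall p, p \in X -> forall a : 'rV[K]_s, a \in p -> line_eval (a 0) f = 0.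
Proof.
split.
  pose J f := forall p, p \in X ->
    forall a : 'rV[K]_s, a \in p -> line_eval (a 0) f = 0.
  apply: (@ideal_gen_min _ _ J) => [|g [[d hg] vg] p pX a ap].
    split=> [p _ a _|g h Jg Jh p pX a ap|h g Jg p pX a ap].
    - exact: rmorph0.
    - by rewrite rmorphD /= (Jg p) // (Jh p) // addr0.
    - by rewrite rmorphM /= (Jg p) // mulr0.
  by rewrite (line_eval_homog _ hg) (vg p) // scale0r.
move=> f0; rewrite (pihomog_partitionE (leqnn (mmeasure mdeg f))).
apply: is_ideal_sum => [|d _]; first exact: ideal_gen_is_ideal.
apply: mem_ideal_gen; split; first by exists d; apply: pihomogP.
by move=> p pX a ap; rewrite -coef_line_eval (f0 p) // coef0.
Qed.

End VanishingIdeal.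

Section PointHeight.
Variables (K : finFieldType) (n : nat) (a : 'I_n.+1 -> K) (i0 : 'I_n.+1).
Hypothesis a_i0 : a i0 = 1.
Local Notation S := {mpoly K[n.+1]}.

Definition point_prime : {pred S} := [pred f | line_eval a f == 0].

Lemma prime_point_prime : prime_ideal point_prime.
Proof. exact: prime_ker. Qed.

(** Identifies the first [l] variables other than [X_i0] with multiples of
    [X_i0], as on the line through [a]. The kernels for [l = 0, 1, .., n] climb
    from the zero ideal to the prime of the point. *)
Definition partial_subst l : n.+1.-tuple S :=
  [tuple if unlift i0 i is Some k then
           if (k < l)%N then a i *: 'X_i0 else 'X_i
         else 'X_i | i < n.+1].

Definition point_chain l : {pred S} := [pred f : S | f \mPo partial_subst l == 0].

Lemma partial_substU l i : 'X_i \mPo partial_subst l =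
  if unlift i0 i is Some k then
    if (k < l)%N then a i *: 'X_i0 else 'X_i
  else 'X_i :> S.
Proof. by rewrite comp_mpolyXU -tnth_nth tnth_mktuple. Qed.

Lemma partial_subst_i0 l : 'X_i0 \mPo partial_subst l = 'X_i0 :> S.
Proof. by rewrite partial_substU unlift_none. Qed.

Lemma partial_subst_comp l l' (f : S) : (l <= l')%N ->
  (f \mPo partial_subst l) \mPo partial_subst l' = f \mPo partial_subst l'.
Proof.
move=> lell'; apply: (eq_mpoly_morph (phi := comp_mpoly (partial_subst l') \o
  comp_mpoly (partial_subst l)) (psi := comp_mpoly (partial_subst l'))) => [c|i] /=.
  by rewrite !comp_mpolyC.
rewrite partial_substU; case: unliftP => [k Di|//].
case: ltnP => // ltkl.
rewrite comp_mpolyZ partial_subst_i0 partial_substU Di liftK.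
by rewrite (leq_trans ltkl lell').
Qed.

Lemma line_eval_partial_subst l (f : S) :
  line_eval a (f \mPo partial_subst l) = line_eval a f.
Proof.
apply: (eq_mpoly_morph (phi := line_eval a \o
  comp_mpoly (partial_subst l)) (psi := line_eval a)) => [c|i] /=.
  by rewrite comp_mpolyC.
rewrite partial_substU; case: unliftP => [k Di|//]; case: ifP => // _.
by rewrite -mul_mpolyC rmorphM /= line_evalC !line_evalU a_i0 scale1r mul_polyC.
Qed.

Lemma point_chain_top : point_chain n =i point_prime.
Proof.
move=> f; rewrite !inE; apply/eqP/eqP => f0.
  by rewrite -(line_eval_partial_subst n) f0 rmorph0.
pose emb : {rmorphism {poly K} -> S} := horner_morph (fun c : K => mulrC ('X_i0 : S) (c%:MP)).
have -> : f \mPo partial_subst n = emb (line_eval a f); last by rewrite f0 rmorph0.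
apply: (eq_mpoly_morph (phi := comp_mpoly (partial_subst n))
  (psi := emb \o line_eval a)) => [c|i] /=.
  by rewrite comp_mpolyC line_evalC horner_morphC.
rewrite partial_substU line_evalU -mul_polyC rmorphM /= horner_morphC horner_morphX.
case: unliftP => [k _|->]; first by rewrite ltn_ord mul_mpolyC.
by rewrite a_i0 rmorph1 mul1r.
Qed.

Lemma point_chain_prime : prime_chain point_chain n.
Proof.
split=> [l _|l ltln]; first exact: prime_ker.
split=> [f|sub].
  rewrite !inE => /eqP f0.
  by rewrite -(partial_subst_comp _ (leqnSn l)) f0 comp_mpoly0.
pose i := lift i0 (Ordinal ltln).
have /sub : 'X_i - a i *: 'X_i0 \in point_chain l.+1.
  rewrite inE comp_mpolyB comp_mpolyZ partial_subst_i0 partial_substU liftK /=.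
  by rewrite ltnSn subrr.
rewrite inE comp_mpolyB comp_mpolyZ partial_subst_i0 partial_substU liftK /=.
rewrite ltnn => /eqP/(congr1 (mcoeff U_(i))); rewrite mcoeffB mcoeffZ mcoeff0.
rewrite !mcoeffXU eqxx (negPf (neq_lift _ _)) mulr0 subr0.
by move/eqP; rewrite oner_eq0.
Qed.

(** The kernels of the partial substitutions give a chain of length [n]. No
    chain below is longer, since the irrelevant maximal ideal lies strictly
    above and extends it to a chain of a ring of dimension [n + 1]. *)
Lemma height_point_prime : prime_height point_prime n.
Proof.
split; first by exists point_chain; split; [exact: point_chain_prime|exact: point_chain_top].
move=> l [C [[pC ltC] topC]].
pose m0 : {pred S} := [pred f : S | f.@[fun=> 0] == 0].
pose C' i := if (i <= l)%N then C i else m0.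
suff /prime_chain_le: prime_chain C' l.+1 by [].
split=> i.
  rewrite /C' => _; case: leqP => [leil|_]; first exact: pC.
  exact: prime_ker.
rewrite ltnS leq_eqVlt /C' => /predU1P[->|ltil]; last first.
  by rewrite (ltnW ltil) ltil; apply: ltC.
rewrite leqnn ltnn; split=> [f|sub].
  rewrite topC !inE => /eqP f0.
  suff <- : (line_eval a f).[0] = f.@[fun=> 0] by rewrite f0 horner0.
  apply: (eq_mpoly_morph (phi := horner_eval 0 \o line_eval a)
     (psi := meval (fun=> 0))) => [c|j] /=.
    by rewrite line_evalC mevalC /horner_eval hornerC.
  by rewrite line_evalU mevalXU /horner_eval hornerZ hornerX mulr0.
have /sub : 'X_i0 \in m0 by rewrite inE mevalXU.
by rewrite topC inE line_evalU a_i0 scale1r polyX_eq0.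
Qed.

End PointHeight.

Section VanishingHeight.
Variables (K : finFieldType) (n : nat) (X : {set {set 'rV[K]_n.+1}}).
Hypothesis X_points : forall p, p \in X -> exists2 a, a != 0 & p = proj_point a.
Hypothesis X_neq0 : X != set0.

(** Rescaling a point so that one coordinate is 1 does not change the
    polynomials that vanish on its line. *)
Lemma normalized_representatives : exists rep : {set 'rV[K]_n.+1} -> 'rV[K]_n.+1,
  forall p, p \in X ->
   (exists i0, rep p 0 i0 = 1) /\
   (forall f, (forall a : 'rV_n.+1, a \in p -> line_eval (a 0) f = 0) <->
              line_eval (rep p 0) f = 0).
Proof.
pose Q p (r : 'rV[K]_n.+1) := p \in X -> (exists i0, r 0 i0 = 1) /\
   (forall f, (forall a : 'rV_n.+1, a \in p -> line_eval (a 0) f = 0) <->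
              line_eval (r 0) f = 0).
suff /fin_all_exists[rep repP] : forall p, exists r, Q p r by exists rep.
move=> p; rewrite /Q; have [pX|_] := boolP (p \in X); last by exists 0.
have [a a0 Dp] := X_points pX.
have /rV0Pn[i0 ai0] := a0.
exists ((a 0 i0)^-1 *: a) => _; split; first by exists i0; rewrite mxE mulVf.
move=> f; split=> [f0|f0 b].
  by apply: f0; rewrite Dp; apply: imset_f; rewrite inE invr_eq0.
rewrite Dp => /imsetP[c _ ->].
have := line_eval_scale_eq0 (c * a 0 i0) f0.
congr (_ = 0); rewrite /line_eval; apply: eq_bigr => m _; congr (_ * _).
by apply: eq_bigr => j _; rewrite !mxE mulrA mulfK.
Qed.

(** A prime [P] containing the vanishing ideal contains the prime of one of the
    points: otherwise, choose in each point prime an element outside [P]; their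
    product vanishes on every point, so lies in [P]. Hence the height of [P] is
    at least that of a point prime, namely [n]. *)
Lemma height_vanishing_ideal : ideal_height (vanishing_ideal X) n.
Proof.
have [rep repP] := normalized_representatives.
have IP f : vanishing_ideal X f <->
    (forall p, p \in X -> f \in point_prime (rep p 0)).
  split=> [/vanishing_idealP f0 p pX|f0].
    by apply/eqP; apply/(proj2 (repP p pX)); apply: f0.
  apply/vanishing_idealP => p pX; apply/(proj2 (repP p pX)).
  by apply/eqP; apply: f0.
have hP p : p \in X -> prime_height (point_prime (rep p 0)) n.
  by case/repP => [[i0 Di0] _]; apply: height_point_prime Di0.
split.
  have /set0Pn[p pX] := X_neq0.
  exists (point_prime (rep p 0)); split; last exact: hP.
  by split=> [|f /IP]; [exact: prime_point_prime | apply].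
move=> P h [pP IsubP] [_ maxP].
have [p pX sub] : exists2 p, p \in X & {subset point_prime (rep p 0) <= P}.
  apply: NNPP => nex.
  have /fin_all_exists[F FP] p : exists f : {mpoly K[n.+1]},
      p \in X -> f \in point_prime (rep p 0) /\ f \notin P.
    apply: NNPP => nf; have [pX|npX] := boolP (p \in X); last first.
      by case: nf; exists 0; rewrite (negPf npX).
    case: nex; exists p => // f fp; apply: contraT => fP.
    by case: nf; exists f.
  have /(prime_prod pP)/hasP[p] : \prod_(p <- enum X) F p \in P.
    apply/IsubP/IP => p pX; rewrite inE rmorph_prod /=.
    rewrite big_enum (bigD1 p) //=.
    by have [/eqP-> _] := FP p pX; rewrite mul0r.
  by rewrite mem_enum => /FP[_ /negPf->].
have [[C [[pC ltC] topC]] _] := hP p pX.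
have [eqP|neqP] := classic ({subset P <= point_prime (rep p 0)}).
  apply: maxP; exists C; split=> // f; rewrite topC.
  by apply/idP/idP => [/sub|/eqP].
apply: leq_trans (leqnSn n) (maxP _ _).
exists (fun i => if (i <= n)%N then C i else P); split; last by rewrite ltnn.
split=> i; first by move=> _; case: leqP => [/pC|].
move=> lein; have [->|ltin] : i = n \/ (i < n)%N by lia.
  rewrite leqnn ltnn; split=> [f|sub']; first by rewrite topC; apply: sub.
  by apply: neqP => f /sub'; rewrite topC.
by rewrite (ltnW ltin) ltin; apply: ltC.
Qed.

End VanishingHeight.

(** * Generation by binomials *)

Section Characters.
Variables (K : fieldType) (T : finType) (op : T -> T -> T) (e : T).

Definition is_character (psi : {ffun T -> K}) : Prop :=
  psi e = 1 /\ forall x y, psi (op x y) = psi x * psi y.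

(** Dedekind's independence of characters, for a set with an arbitrary binary
    operation. *)
Lemma characters_independent (s : seq {ffun T -> K}) (c : {ffun T -> K} -> K) :
  uniq s -> (forall psi, psi \in s -> is_character psi) ->
  (forall x, \sum_(psi <- s) c psi * psi x = 0) ->
  forall psi, psi \in s -> c psi = 0.
Proof.
elim: s c => [|psi0 s IH] c //= /andP[psi0s us] chs c0.
have chs' psi : psi \in s -> is_character psi.
  by move=> psis; apply: chs; rewrite inE psis orbT.
have cs psi : psi \in s -> c psi = 0.
  move=> psis; have [x0 neq0] : exists x0, psi x0 != psi0 x0.
    apply/existsP; apply: contraR psi0s; rewrite negb_exists => /forallP eqpsi.
    suff <- : psi = psi0 by [].
    by apply/ffunP => x; apply/eqP; have := eqpsi x; rewrite negbK.
  have := IH (fun chi => c chi * (chi x0 - psi0 x0)) us chs'.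
  suff c'0 x : \sum_(chi <- s) c chi * (chi x0 - psi0 x0) * chi x = 0.
    by move/(_ c'0 psi psis)/eqP; rewrite mulf_eq0 subr_eq0 (negPf neq0) orbF => /eqP.
  have : \sum_(chi <- psi0 :: s) c chi * (chi x0 - psi0 x0) * chi x = 0.
    rewrite big_seq (eq_bigr (fun chi => c chi * chi (op x0 x) -
        psi0 x0 * (c chi * chi x))); last first.
      by move=> chi /chs[_ ->]; ring.
    by rewrite -big_seq sumrB -mulr_sumr !c0 mulr0 subr0.
  by rewrite big_cons subrr mulr0 mul0r add0r.
move=> psi; rewrite inE => /predU1P[->|/cs//].
have [psi0e _] := chs psi0 (mem_head _ _).
have := c0 e; rewrite big_cons psi0e mulr1 big_seq big1 ?addr0 // => chi /cs ->.
by rewrite mul0r.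
Qed.
End Characters.

Definition vanishing_binomial (K : finFieldType) (s : nat)
    (X : {set {set 'rV[K]_s}}) (g : {mpoly K[s]}) : Prop :=
  exists m1 m2 : 'X_{1..s},
    [/\ mdeg m1 = mdeg m2, g = 'X_[m1] - 'X_[m2] & vanishes X g].

Definition unit_pt (K : finFieldType) (n : nat) (i : 'I_n) : 'I_n -> K :=
  fun j => (i == j)%:R.

Section ParameterizedSet.
Variables (K : finFieldType) (n s : nat) (v : 'I_s.+1 -> 'X_{1..n}).
Local Notation S := {mpoly K[s.+1]}.
Local Notation X := (param_set K v).

(** The monomial [m] in the parameterized coordinates, as a function of the
    parameters. It is multiplicative for the entrywise product of parameters,
    and this is what forces the relations among monomials to be binomial. *)
Definition coord_char (m : 'X_{1..s.+1}) : {ffun 'rV[K]_n -> K} :=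
  [ffun x => ('X_[m] : S).@[mon_eval v x 0]].

Lemma coord_char_character m :
  is_character (fun x y : 'rV[K]_n => map2_mx *%R x y) (const_mx 1) (coord_char m).
Proof.
split=> [|x y]; rewrite !ffunE !mevalX.
  rewrite big1 // => i _; rewrite mxE mevalX big1 ?expr1n // => j _.
  by rewrite mxE expr1n.
rewrite -big_split /=; apply: eq_bigr => i _; rewrite -exprMn; congr (_ ^+ _).
rewrite !mxE !mevalX -big_split /=; apply: eq_bigr => j _.
by rewrite mxE exprMn.
Qed.

Lemma mon_eval1 : mon_eval v (const_mx 1 : 'rV[K]_n) = const_mx 1.
Proof.
apply/rowP => i; rewrite !mxE mevalX big1 // => j _.
by rewrite mxE expr1n.
Qed.

Lemma mem_param_set x : mon_eval v x != 0 -> proj_point (mon_eval v x) \in X.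
Proof. by move=> x0; apply: imset_f; rewrite inE. Qed.

Lemma mem_proj_point (a : 'rV[K]_s.+1) : a \in proj_point a.
Proof. by apply/imsetP; exists 1; rewrite ?inE ?oner_neq0 ?scale1r. Qed.

Lemma const_mx1_neq0 : const_mx 1 != 0 :> 'rV[K]_s.+1.
Proof.
apply/eqP => /rowP/(_ ord0); rewrite !mxE => /eqP.
by rewrite oner_eq0.
Qed.

Lemma param_set_points p : p \in X -> exists2 a, a != 0 & p = proj_point a.
Proof. by case/imsetP => x; rewrite inE => x0 ->; exists (mon_eval v x). Qed.

Lemma param_set_neq0 : X != set0.
Proof.
apply/set0Pn; exists (proj_point (mon_eval v (const_mx 1))).
by apply: mem_param_set; rewrite mon_eval1 const_mx1_neq0.
Qed.

(** Homogeneity also covers the parameters [x] at which all the monomials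
    vanish, which define no projective point. *)
Lemma vanishes_mon_eval (f : S) d x : f \is d.-homog -> vanishes X f ->
  f.@[mon_eval v x 0] = 0.
Proof.
move=> hf vf; have [x0|x0] := eqVneq (mon_eval v x) 0; last first.
  by apply: (vf _ (mem_param_set x0)); apply: mem_proj_point.
have f1 : f.@[(const_mx 1 : 'rV[K]_s.+1) 0] = 0.
  apply: (vf (proj_point (mon_eval v (const_mx 1)))).
    by rewrite mem_param_set // mon_eval1 const_mx1_neq0.
  by rewrite mon_eval1 mem_proj_point.
rewrite (meval_eq (v2 := fun i => 0 * (const_mx 1 : 'rV[K]_s.+1) 0 i)) => [|i].
  by rewrite (meval_homog_scale _ _ hf) f1 mulr0.
by rewrite x0 mxE mul0r.
Qed.

Lemma mon_eval_vanishes (f : S) d : f \is d.-homog ->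
  (forall x, f.@[mon_eval v x 0] = 0) -> vanishes X f.
Proof.
move=> hf f0 _ /imsetP[x _ ->] _ /imsetP[c _ ->].
rewrite (meval_eq (v2 := fun i => c * mon_eval v x 0 i)) => [|i]; last by rewrite mxE.
by rewrite (meval_homog_scale _ _ hf) f0 mulr0.
Qed.

(** Group the monomials of a homogeneous [f] vanishing on [X] by the character
    that they induce on the parameters. Characters are independent, so the
    coefficients in each group sum to zero, and subtracting from each monomial
    the representative [rep] of its group writes [f] by binomials. *)
Lemma vanishing_ideal_binomial (f : S) :
  vanishing_ideal X f -> ideal_gen (vanishing_binomial X) f.
Proof.
have iG := ideal_gen_is_ideal (vanishing_binomial X).
apply: ideal_gen_min => // {}f [[d hf] vf].
have degf m : m \in msupp f -> mdeg m = d by apply/dhomogP.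
pose rep psi := nth 0%MM (msupp f) (find (fun m => coord_char m == psi) (msupp f)).
have repP m : m \in msupp f ->
    rep (coord_char m) \in msupp f /\ coord_char (rep (coord_char m)) = coord_char m.
  move=> mf; have hasm : has (fun m' => coord_char m' == coord_char m) (msupp f).
    by apply/hasP; exists m.
  by split; [rewrite mem_nth // -has_find | apply/eqP/(nth_find _ hasm)].
pose c psi := \sum_(m <- msupp f | coord_char m == psi) f@_m.
pose chars := undup [seq coord_char m | m <- msupp f].
have split_chars (V : nmodType) (F : {ffun 'rV[K]_n -> K} -> 'X_{1..s.+1} -> V) :
    \sum_(m <- msupp f) F (coord_char m) m =
    \sum_(psi <- chars) \sum_(m <- msupp f | coord_char m == psi) F psi m.
  rewrite (exchange_big_dep predT) //= big_seq [RHS]big_seq.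
  apply: eq_bigr => m mf.
  rewrite big_mkcond /=.
  rewrite (bigD1_seq (coord_char m)) ?undup_uniq ?mem_undup ?map_f //= ?eqxx //.
  by rewrite big1 ?addr0 // => psi; rewrite eq_sym => /negPf->.
have c0 psi : psi \in chars -> c psi = 0.
  apply: (@characters_independent _ _ (fun x y : 'rV[K]_n => map2_mx *%R x y) (const_mx 1)) => [|chi|x].
  - exact: undup_uniq.
  - rewrite mem_undup => /mapP[m _ ->]; exact: coord_char_character.
  transitivity f.@[mon_eval v x 0]; last exact: vanishes_mon_eval hf vf.
  rewrite [in RHS](mpolyE f) rmorph_sum /=.
  rewrite (eq_bigr (fun m => f@_m * coord_char m x)); last first.
    by move=> m _; rewrite mevalZ ffunE.
  rewrite (split_chars _ (fun psi m => f@_m * psi x)).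
  by apply: eq_bigr => chi _; rewrite mulr_suml.
have -> : f = \sum_(m <- msupp f) (f@_m)%:MP * ('X_[m] - 'X_[rep (coord_char m)]).
  under eq_bigr do rewrite mulrBr !mul_mpolyC.
  rewrite sumrB -mpolyE (split_chars _ (fun psi m => f@_m *: 'X_[rep psi])).
  rewrite [X in _ - X]big_seq big1 ?subr0 // => psi psic.
  by rewrite -scaler_suml -/(c psi) c0 // scale0r.
rewrite big_seq; apply: is_ideal_sum => // m mf; have [rf cf] := repP m mf.
case: iG => _ _; apply; apply: mem_ideal_gen; exists m, (rep (coord_char m)).
split=> //; first by rewrite !degf.
apply: (@mon_eval_vanishes _ d).
  by rewrite rpredB // dhomogX; apply/eqP; apply: degf.
move=> x; have /ffunP/(_ x) := cf; rewrite !ffunE => cfx.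
by rewrite mevalB cfx subrr.
Qed.

Hypothesis hv : forall i j, i != j -> ~~ (mon_supp (v i) \subset mon_supp (v j)).

(** The coordinate points are in the parameterized set: since no other support
    lies inside the support of [v i], the indicator of that support kills all
    the monomials except the [i]-th. *)
Lemma vanishes_unit_point (f : S) (i : 'I_s.+1) :
  homogeneous f -> vanishes X f -> f.@[unit_pt K i] = 0.
Proof.
case=> d hf vf.
pose x : 'rV[K]_n := \row_k (k \in mon_supp (v i))%:R.
rewrite -(vanishes_mon_eval x hf vf); apply: meval_eq => j.
rewrite /unit_pt mxE mevalX; have [<-|neq_ij] := eqVneq i j.
  rewrite big1 // => k _; rewrite mxE inE lt0n.
  by have [->|] := eqVneq (v i k) 0%N; rewrite ?expr0 ?expr1n.
have /subsetPn[k kj ki] : ~~ (mon_supp (v j) \subset mon_supp (v i)).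
  by apply: hv; rewrite eq_sym.
rewrite (bigD1 k) //= mxE (negPf ki) expr0n.
by move: kj; rewrite inE lt0n => /negPf->; rewrite mul0r.
Qed.

End ParameterizedSet.

(** * Discarding superfluous generators *)

Section DropGenerator.
Variables (K : finFieldType) (n : nat).
Local Notation S := {mpoly K[n]}.

Lemma pihomogM_homog d e (h b : S) : b \is e.-homog ->
  pihomog mdeg d (h * b) = (if (e <= d)%N then pihomog mdeg (d - e) h else 0) * b.
Proof.
move=> hb; rewrite {1}(mpolyE h) mulr_suml raddf_sum /=.
have -> : (if (e <= d)%N then pihomog mdeg (d - e) h else 0) =
    \sum_(m <- msupp h) h@_m *: (if (mdeg m + e)%N == d then 'X_[m] else 0).
  case: leqP => [leed|lted]; last first.
    by rewrite big1 // => m _; rewrite ifF ?scaler0 //; lia.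
  rewrite pihomogE big_mkcond /=; apply: eq_bigr => m _.
  by rewrite -(eqn_add2r e) subnK //; case: ifP; rewrite ?scaler0.
rewrite mulr_suml; apply: eq_bigr => m _; rewrite -!scalerAl linearZ /=.
have hmb : 'X_[m] * b \is (mdeg m + e).-homog by apply: dhomogM; rewrite ?dhomogX.
congr (_ *: _); case: eqP => [<-|/eqP ne]; first by rewrite pihomog_dE.
by rewrite (pihomog_ne0 ne hmb) mul0r.
Qed.

Lemma pihomog0E (h : S) : pihomog mdeg 0 h = (h@_0%MM)%:MP.
Proof.
rewrite [in LHS](mpolyE h) [in RHS](mpolyE h) !raddf_sum /=.
apply: eq_bigr => m _; rewrite linearZ /= mcoeffZ mcoeffX pihomogX mdeg_eq0.
by case: eqP => [->|_]; rewrite ?mulr1 ?mulr0 ?scaler0 // mpolyX0 alg_mpolyC.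
Qed.

(** Expressing [B] by [gs] and back gives a matrix factoring through a smaller
    dimension, so its constant part is not the identity. This yields a relation
    among the elements of [B] in which some coefficient [u j] has a nonzero
    constant term. In the component of the degree of [B`_j] that coefficient
    becomes the constant, and [B`_j] is a combination of the others: this is
    the graded Nakayama lemma. *)
Lemma drop_generator (B gs : seq S) :
  (forall b, b \in B -> homogeneous b) ->
  (forall b, b \in B -> ideal_of_seq gs b) ->
  (forall g, g \in gs -> ideal_of_seq B g) ->
  (size gs < size B)%N ->
  exists B' : seq S, [/\ {subset B' <= B}, (size B' < size B)%N &
                        forall b, b \in B -> ideal_of_seq B' b].
Proof.
move=> hB Bgs gsB ltgB; set k := size B; set r := size gs.
have /fin_all_exists[C DC] (i : 'I_k) :
    exists c : 'I_r -> S, B`_i = \sum_l c l * gs`_l.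
  by apply/ideal_of_seqP/Bgs; rewrite mem_nth.
have /fin_all_exists[A DA] (l : 'I_r) :
    exists a : 'I_k -> S, gs`_l = \sum_i a i * B`_i.
  by apply/ideal_of_seqP/gsB; rewrite mem_nth.
pose C0 := \matrix_(i < k, l < r) (C i l)@_0%MM.
pose A0 := \matrix_(l < r, i < k) (A l i)@_0%MM.
have neq1 : C0 *m A0 != 1%:M.
  apply: contraTneq ltgB => CA1; rewrite -leqNgt -/k -/r -(mxrank1 K k) -CA1.
  exact: leq_trans (mxrankM_maxr _ _) (rank_leq_row _).
have [i [j neq_ij]] : exists i j, (C0 *m A0) i j != (i == j)%:R.
  apply: NNPP => nex; case/eqP: neq1; apply/matrixP => i j; rewrite [RHS]mxE.
  by apply/eqP; apply: contraT => ne; case: nex; exists i, j.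
pose u j' := \sum_l C i l * A l j' - (i == j')%:R.
have u_rel : \sum_j' u j' * B`_j' = 0.
  under eq_bigr do rewrite mulrBl.
  rewrite sumrB [X in _ - X](bigD1 i) //= eqxx mul1r.
  rewrite [X in _ - (_ + X)]big1 => [|j' /negPf]; last by rewrite eq_sym => ->; rewrite mul0r.
  rewrite addr0 [X in _ - X]DC -[X in _ - X]/(\sum_l _).
  apply/eqP; rewrite subr_eq0; apply/eqP; under eq_bigr do rewrite mulr_suml.
  rewrite exchange_big; apply: eq_bigr => l _ /=; rewrite DA mulr_sumr.
  by apply: eq_bigr => j' _; rewrite mulrA.
have uj0 : (u j)@_0%MM != 0.
  rewrite mcoeffB raddf_sum /=.
  have -> : ((i == j)%:R : S)@_0%MM = (i == j)%:R by rewrite raddfMn /= mcoeff1 eqxx.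
  rewrite subr_eq0; apply: contra neq_ij => /eqP <-; rewrite mxE; apply/eqP.
  by apply: eq_bigr => l _; rewrite !mxE (rmorphM (mcoeff 0%MM)).
have /fin_all_exists[d hd] (j' : 'I_k) : exists d, B`_j' \is d.-homog.
  by apply: hB; rewrite mem_nth.
pose w j' := if (d j' <= d j)%N then pihomog mdeg (d j - d j') (u j') else 0.
have w_rel : \sum_j' w j' * B`_j' = 0.
  have := congr1 (pihomog mdeg (d j)) u_rel; rewrite raddf0 raddf_sum /=.
  by apply: etrans; apply: eq_bigr => j' _; rewrite (pihomogM_homog _ _ (hd j')).
have wj : w j = ((u j)@_0%MM)%:MP by rewrite /w leqnn subnn pihomog0E.
pose B' := [seq B`_(nat_of_ord i) | i : 'I_k <- enum 'I_k & i != j].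
have mem_B' (j' : 'I_k) : j' != j -> B`_j' \in B'.
  by move=> nej; apply: map_f; rewrite mem_filter nej mem_enum.
have iB' := ideal_gen_is_ideal (fun g => g \in B').
have Bj : ideal_of_seq B' B`_j.
  have -> : B`_j = ((u j)@_0%MM)^-1%:MP * - \sum_(j' | j' != j) w j' * B`_j'.
    move: w_rel; rewrite (bigD1 j) //= wj => /eqP; rewrite addr_eq0 => /eqP <-.
    by rewrite mulrA -mpolyCM mulVf // mpolyC1 mul1r.
  case: (iB') => _ _; apply; apply: is_idealN => //; apply: is_ideal_sum => //.
  move=> j' nej; case: (iB') => _ _; apply; apply: mem_ideal_gen; exact: mem_B'.
exists B'; split=> [b|| b /(nthP 0)[m ltm <-]].
- by case/mapP => m _ ->; rewrite mem_nth.
- rewrite size_map size_filter -[X in (_ < X)%N](size_enum_ord k).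
  rewrite -(count_predC (pred1 j) (enum 'I_k)) -[X in (X < _)%N]add0n.
  rewrite ltn_add2r -has_count has_pred1 mem_enum //.
have [Dm|nem] := eqVneq (Ordinal ltm) j; first by rewrite -[m]/(val (Ordinal ltm)) Dm.
apply: mem_ideal_gen; exact: (mem_B' (Ordinal ltm)).
Qed.

Lemma few_generators (B gs : seq S) :
  (forall b, b \in B -> homogeneous b) ->
  (forall b, b \in B -> ideal_of_seq gs b) ->
  (forall g, g \in gs -> ideal_of_seq B g) ->
  exists B' : seq S, [/\ {subset B' <= B}, (size B' <= size gs)%N &
                        forall g, g \in gs -> ideal_of_seq B' g].
Proof.
move: {2}(size B) (leqnn (size B)) => k; elim: k B => [|k IH] B szB hB Bgs gsB.
  by exists B; split=> //; apply: (leq_trans szB).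
have [leBg|ltgB] := leqP (size B) (size gs); first by exists B; split.
have [B1 [sub1 sz1 BB1]] := drop_generator hB Bgs gsB ltgB.
have szB1 : (size B1 <= k)%N by rewrite -ltnS (leq_trans sz1).
have hB1 b : b \in B1 -> homogeneous b by move/sub1/hB.
have B1gs b : b \in B1 -> ideal_of_seq gs b by move/sub1/Bgs.
have gsB1 g : g \in gs -> ideal_of_seq B1 g by move/gsB; apply: ideal_of_seq_sub.
have [B' [sub' sz' gsB']] := IH B1 szB1 hB1 B1gs gsB1.
by exists B'; split=> // b /sub'/sub1.
Qed.

End DropGenerator.

(** * Tangent conditions at the coordinate points *)

Section Tangents.
Variables (K : finFieldType) (n : nat).
Local Notation S := {mpoly K[n.+1]}.
Implicit Types (m : 'X_{1..n.+1}) (i j : 'I_n.+1).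
Local Notation unit_pt := (unit_pt K).

(** The [j]-th coordinate of the differential of [f] at the coordinate point
    [unit_pt i]. *)
Definition tangent i j (f : S) : K := (f^`M(j)).@[unit_pt i].

(** The only monomial of degree [d] with a nonzero [j]-th partial derivative at
    the [i]-th coordinate point, where [i != j]. *)
Definition tangent_mnm i j d : 'X_{1..n.+1} := (U_(j) + U_(i) *+ d.-1)%MM.

(** At a common zero of the generators, the Leibniz rule makes differentials
    linear over evaluation of the coefficients. *)
Lemma mderiv_eval_gen (gs : seq S) (a : 'I_n.+1 -> K) (h : 'I_(size gs) -> S) j :
  (forall g, g \in gs -> g.@[a] = 0) ->
  ((\sum_k h k * gs`_k)^`M(j)).@[a] = \sum_k (h k).@[a] * (gs`_k^`M(j)).@[a].
Proof.
move=> gs0; rewrite (raddf_sum (mderiv j)) raddf_sum; apply: eq_bigr => k _ /=.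
by rewrite mderivM mevalD !mevalM (gs0 gs`_k) ?mem_nth // mulr0 add0r.
Qed.

Lemma unit_pt_mnm i m :
  ('X_[m] : S).@[unit_pt i] = (m == (U_(i) *+ mdeg m)%MM)%:R.
Proof.
rewrite mevalX; have [Dm|nem] := eqVneq m (U_(i) *+ mdeg m)%MM.
  rewrite big1 // => j _; rewrite Dm mulmnE mnm1E /unit_pt.
  by case: eqP; rewrite ?expr1n // mul0n expr0.
have [j nej mj] : exists2 j, i != j & m j != 0%N.
  apply: NNPP => nex; case/eqP: nem.
  have m0 j : j != i -> m j = 0%N.
    move=> nej; apply/eqP; apply: contraT => mj; case: nex; exists j => //.
    by rewrite eq_sym.
  apply/mnmP => j; rewrite mulmnE mnm1E mdegE (bigD1 i) //= big1 // addn0.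
  by have [->|/negPf nej] := eqVneq i j; rewrite ?mul1n // m0 // eq_sym nej.
by rewrite (bigD1 j) //= /unit_pt (negPf nej) expr0n (negPf mj) mul0r.
Qed.

Lemma tangent_mnmE i j m : i != j ->
  tangent i j 'X_[m] = (m == tangent_mnm i j (mdeg m))%:R.
Proof.
move=> neij; rewrite /tangent mderivX mevalZ unit_pt_mnm.
have [Dm|nem] := eqVneq m (tangent_mnm i j (mdeg m)).
  have mj : m j = 1%N by rewrite Dm mnmDE mulmnE !mnm1E eqxx (negPf neij).
  rewrite mj mul1r; have -> : (m - U_(j) = U_(i) *+ (mdeg m).-1)%MM.
    by rewrite {1}Dm /tangent_mnm addmC addmK.
  by rewrite mdegMn mdeg1 mul1n eqxx.
have [->|mj] := eqVneq (m j) 0%N; first by rewrite mul0r.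
case: eqP => [Dm|_]; last by rewrite mulr0.
have leU : (U_(j) <= m)%MM.
  apply/mnm_lepP => k; rewrite mnm1E; case: eqP => // <-.
  by rewrite lt0n.
case/eqP: nem; rewrite -{1}(submK leU) Dm addmC; congr (_ + _ *+ _)%MM.
by rewrite -{2}(submK leU) mdegD mdeg1 addn1.
Qed.

Definition frob_binomial i j : S := 'X_i ^+ #|K| * 'X_j - 'X_i * 'X_j ^+ #|K|.

Lemma frob_binomialE i j : frob_binomial i j =
  'X_[U_(j) + U_(i) *+ #|K|] - 'X_[U_(i) + U_(j) *+ #|K|].
Proof. by rewrite !mpolyXD -!mpolyXn [X in X - _]mulrC. Qed.

Lemma frob_binomial_vanishing (X : {set {set 'rV[K]_n.+1}}) i j :
  vanishing_ideal X (frob_binomial i j).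
Proof.
apply: mem_ideal_gen; split.
  exists #|K|.+1; rewrite frob_binomialE rpredB // dhomogX;
  by rewrite /= mdegD mdegMn !mdeg1 mul1n.
move=> p _ a _; rewrite mevalB !mevalM !rmorphXn /= !mevalXU !expf_card.
by rewrite subrr.
Qed.

(** The vanishing ideal contains binomials whose differentials at a coordinate
    point are the dual basis of the directions leaving that point. *)
Lemma tangent_frob i j k : i != j -> i != k ->
  tangent i k (frob_binomial i j) = (j == k)%:R.
Proof.
move=> neij neik; rewrite frob_binomialE /tangent mderivB mevalB.
rewrite -!/(tangent _ _ _) !tangent_mnmE // !mdegD !mdegMn !mdeg1 !mul1n add1n /=.
have q1 := card_finNzRing_gt1 K.
rewrite [X in _ - X](_ : _ = 0) ?subr0; last first.
  case: eqP => // /mnmP/(_ i); rewrite !mnmDE !mulmnE !mnm1E eqxx.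
  rewrite ![_ == i]eq_sym (negPf neij) (negPf neik) /= mul1n add0n => q_1.
  by move: q1; rewrite -q_1.
have [->|nejk] := eqVneq j k; first by rewrite eqxx.
case: eqP => // /mnmP/(_ j); rewrite !mnmDE !mulmnE !mnm1E eqxx.
by rewrite eq_sym in nejk; rewrite (negPf neij) (negPf nejk).
Qed.

Variables (X : {set {set 'rV[K]_n.+1}}) (B : seq S).
Hypothesis B_gen : eq_ideal (vanishing_ideal X) (ideal_of_seq B).
Hypothesis B_unit : forall b i, b \in B -> b.@[unit_pt i] = 0.

Lemma tangent_covered i j : i != j -> exists2 b, b \in B & tangent i j b != 0.
Proof.
move=> neij.
have /B_gen/ideal_of_seqP[h Df] := frob_binomial_vanishing X i j.
apply: NNPP => nex; have /eqP := tangent_frob neij neij.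
rewrite Df /tangent mderiv_eval_gen => [|b bB]; last exact: B_unit.
rewrite big1 ?eqxx 1?eq_sym ?oner_eq0 // => k _; apply/eqP; rewrite mulf_eq0.
apply/orP; right; apply: contraT => ne; case: nex.
by exists B`_k; rewrite ?mem_nth.
Qed.

(** The differentials at a coordinate point span an [n]-dimensional space. When
    there are at most [n] generators, theirs are linearly independent, so none
    of them is zero. *)
Lemma tangent_neq0 : (size B <= n)%N ->
  forall b i, b \in B -> exists2 j, i != j & tangent i j b != 0.
Proof.
move=> szB b i bB; apply: NNPP => nex.
have /fin_all_exists[h Dh] (j : 'I_n) : exists h : 'I_(size B) -> S,
    frob_binomial i (lift i j) = \sum_k h k * B`_k.
  by apply/ideal_of_seqP/B_gen/frob_binomial_vanishing.
pose H := \matrix_(j < n, k < size B) (h j k).@[unit_pt i].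
pose L := \matrix_(k < size B, j < n) tangent i (lift i j) B`_k.
have HL : H *m L = 1%:M.
  apply/matrixP => j j'; rewrite !mxE -(inj_eq (@lift_inj _ i)).
  rewrite -(tangent_frob (neq_lift i j) (neq_lift i j')) Dh /tangent mderiv_eval_gen.
    by apply: eq_bigr => k _; rewrite !mxE.
  by move=> g gB; apply: B_unit.
have freeL : row_free L.
  rewrite -row_leq_rank (leq_trans szB) // -{1}(mxrank1 K n) -HL.
  exact: mxrankM_maxr.
have ltb : (index b B < size B)%N by rewrite index_mem.
have Lb0 : delta_mx 0 (Ordinal ltb) *m L = 0 :> 'rV_n.
  apply/rowP => j; rewrite -rowE !mxE nth_index //; apply/eqP.
  by apply: contraT => ne; case: nex; exists (lift i j); rewrite ?neq_lift.
have /rowP/(_ (Ordinal ltb))/eqP := row_free_inj freeL (etrans Lb0 (esym (mul0mx _ _))).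
by rewrite !mxE !eqxx oner_eq0.
Qed.

End Tangents.

(** * The shape of the generators *)

Definition equal_up_to_sign (R : zmodType) (b c : R) : Prop := b = c \/ b = - c.

Lemma is_ideal_up_to_sign (R : comNzRingType) (J : R -> Prop) f g :
  is_ideal J -> equal_up_to_sign f g -> J f <-> J g.
Proof.
by move=> iJ [->|->] //; split=> /(is_idealN iJ); rewrite ?opprK.
Qed.

Lemma mem_uniq_ord n (r : seq 'I_n) i : uniq r -> size r = n -> i \in r.
Proof.
move=> ur sz_r; have := uniq_min_size ur (fun x _ => mem_enum 'I_n x).
by rewrite size_enum_ord sz_r leqnn => /(_ isT)[_ /(_ i)]; rewrite mem_enum => ->.
Qed.

Section MonomialShapes.
Variable n : nat.
Implicit Types (m : 'X_{1..n.+1}) (i j k l : 'I_n.+1).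

Lemma tangent_mnm_deg2 i j : tangent_mnm i j 2 = (U_(j) + U_(i))%MM.
Proof. by rewrite /tangent_mnm /= mulm1n. Qed.

Lemma tangent_mnm_inj i j k l d : (2 < d)%N ->
  tangent_mnm i j d = tangent_mnm k l d -> i = k.
Proof.
move=> d2 /mnmP/(_ i); rewrite !mnmDE !mulmnE !mnm1E eqxx.
by case: (k =P i) => // _; case: (_ == _); case: (_ == _) => /=; lia.
Qed.

Lemma card_mon_supp m : (#|mon_supp m| <= mdeg m)%N.
Proof.
rewrite mdegE -sum1_card [X in (_ <= X)%N](bigID (mem (mon_supp m))) /=.
apply: leq_trans (leq_addr _ _); apply: leq_sum => i.
by rewrite inE.
Qed.

Lemma mnm_deg2 m k l : mdeg m = 2%N -> k != l -> (0 < m k)%N -> (0 < m l)%N ->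
  m = (U_(l) + U_(k))%MM.
Proof.
move=> dm nekl mk ml; have leU : (U_(l) + U_(k) <= m)%MM.
  apply/mnm_lepP => i; rewrite mnmDE !mnm1E.
  have [<-|_] := eqVneq l i; first by rewrite (negPf nekl).
  by have [<-|_] := eqVneq k i.
have := mdegD (m - (U_(l) + U_(k)))%MM (U_(l) + U_(k))%MM.
rewrite submK // dm mdegD !mdeg1 => d0.
have : mdeg (m - (U_(l) + U_(k)))%MM == 0%N by apply/eqP; lia.
by rewrite mdeg_eq0 -[RHS]add0m -[LHS](submK leU) => /eqP->.
Qed.

End MonomialShapes.

Section GeneratorShape.
Variables (K : finFieldType) (n : nat) (X : {set {set 'rV[K]_n.+1}}).
Local Notation S := {mpoly K[n.+1]}.
Variable B : seq S.
Hypothesis B_gen : eq_ideal (vanishing_ideal X) (ideal_of_seq B).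
Hypothesis B_bin : forall b, b \in B -> vanishing_binomial X b.
Hypothesis B_unit : forall b i, b \in B -> b.@[unit_pt K i] = 0.
Hypothesis B_few : (size B <= n)%N.

(** A binomial has only two monomials, and at every coordinate point one of
    them must carry a nonzero derivative ([tangent_neq0]). Vanishing at the
    coordinate points excludes pure powers, whence [1 < d]. *)
Lemma generator_shape b i j : b \in B -> i != j -> tangent i j b != 0 ->
  exists d (m : 'X_{1..n.+1}),
    [/\ equal_up_to_sign b ('X_[tangent_mnm i j d] - 'X_[m]),
        [/\ (1 < d)%N, mdeg m = d & m != tangent_mnm i j d],
        forall k, m != (U_(k) *+ d)%MM
      & forall k, exists2 l, k != l &
          tangent_mnm i j d = tangent_mnm k l d \/ m = tangent_mnm k l d].
Proof.
move=> bB neij tb; have [m1 [m2 [deg12 Db _]]] := B_bin bB.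
pose d := mdeg m1.
have tE k l : k != l -> tangent k l b =
    (m1 == tangent_mnm k l d)%:R - (m2 == tangent_mnm k l d)%:R.
  move=> nekl; rewrite Db /tangent mderivB mevalB -!/(tangent _ _ _).
  by rewrite !tangent_mnmE // -deg12.
have ne12 : m1 != m2.
  by apply: contraNneq tb => e12; rewrite tE // e12 subrr.
have cover k : exists2 l, k != l & m1 = tangent_mnm k l d \/ m2 = tangent_mnm k l d.
  have [l nekl tl] := tangent_neq0 B_gen B_unit B_few k bB.
  exists l => //; move: tl; rewrite tE //.
  case: (m1 =P _) => [->|_]; first by left.
  by case: (m2 =P _) => [->|_]; [right | rewrite subrr eqxx].
have pure k : (m1 != (U_(k) *+ d)%MM) && (m2 != (U_(k) *+ d)%MM).
  have := B_unit k bB; rewrite Db mevalB !unit_pt_mnm -deg12 -/d.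
  case: (m1 =P _) => [D1|_]; case: (m2 =P _) => [D2|_] //=.
  - by case/eqP: ne12; rewrite D1 D2.
  - by rewrite subr0 => /eqP; rewrite oner_eq0.
  - by rewrite sub0r => /eqP; rewrite oppr_eq0 oner_eq0.
have deg_t (k l : 'I_n.+1) : mdeg (tangent_mnm k l d) = d.-1.+1.
  by rewrite mdegD mdegMn !mdeg1 mul1n add1n.
have d1 : (1 < d)%N.
  have [l _ Dl] := cover i; have d0 : (0 < d)%N.
    by case: Dl => Dm; have := deg_t i l; rewrite -Dm -?deg12 -/d => ->.
  rewrite ltnNge; apply/negP => d_le1; have d1 : d = 1%N by lia.
  have /andP[] := pure l; move: Dl.
  by rewrite /tangent_mnm d1 /= mulm0n addm0 mulm1n => -[->|->]; rewrite eqxx.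
have: (m1 == tangent_mnm i j d) || (m2 == tangent_mnm i j d).
  by apply: contraNT tb; rewrite negb_or tE // => /andP[/negPf-> /negPf->]; rewrite subrr.
case/orP => /eqP Dt; exists d.
  exists m2; rewrite -Dt; split=> //; first by left.
    by split; rewrite // eq_sym.
  by move=> k; case/andP: (pure k).
exists m1; rewrite -Dt; split=> //.
- by right; rewrite opprB.
- by move=> k; case/andP: (pure k).
by move=> k; have [l nekl Dl] := cover k; exists l => //; case: Dl; [right|left].
Qed.

(** In degree [d > 2] a tangent monomial serves a single coordinate point, so
    two monomials cannot serve three points. In degree 2 the monomial other than
    [X_i X_j] has to serve all the remaining points. *)
Lemma generator_quadratic : (1 < n)%N ->
  forall b i j, b \in B -> i != j -> tangent i j b != 0 ->
  exists m : 'X_{1..n.+1},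
    [/\ equal_up_to_sign b ('X_i * 'X_j - 'X_[m]), mdeg m = 2%N &
        forall k, k != i -> k != j -> exists2 l, k != l & m = (U_(l) + U_(k))%MM].
Proof.
move=> n1 b i j bB neij tb.
have [d [m [Db [d1 dm _] _ cov]]] := generator_shape bB neij tb.
have d2 : d = 2%N.
  apply/eqP; rewrite eqn_leq d1 andbT leqNgt; apply/negP => d2.
  pose i0 : 'I_n.+1 := inord 0; pose i1 : 'I_n.+1 := inord 1.
  pose i2 : 'I_n.+1 := inord 2.
  have v0 : i0 = 0%N :> nat by rewrite inordK.
  have v1 : i1 = 1%N :> nat by rewrite inordK // ltnS ltnW.
  have v2 : i2 = 2%N :> nat by rewrite inordK // ltnS.
  have [l0 _ E0] := cov i0; have [l1 _ E1] := cov i1; have [l2 _ E2] := cov i2.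
  have inj (k l k' l' : 'I_n.+1) : tangent_mnm k l d = tangent_mnm k' l' d -> k = k' :> nat.
    by move=> /(tangent_mnm_inj d2) ->.
  case: E0 => E0; case: E1 => E1; case: E2 => E2;
    (try by have := inj _ _ _ _ (etrans (esym E0) E1); rewrite v0 v1);
    (try by have := inj _ _ _ _ (etrans (esym E0) E2); rewrite v0 v2);
    by have := inj _ _ _ _ (etrans (esym E1) E2); rewrite v1 v2.
move: Db cov dm; rewrite d2 tangent_mnm_deg2 mpolyXD mulrC => Db cov dm.
exists m; split=> // k neki nekj; have [l nekl] := cov k.
rewrite tangent_mnm_deg2; case=> [/mnmP/(_ k)|Dm]; last by exists l.
by rewrite !mnmDE !mnm1E eqxx ![_ == k]eq_sym (negPf neki) (negPf nekj) addnC.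
Qed.

(** Two monomials of degree 2 involve at most four variables, and a generator
    involves all of them. *)
Lemma at_most_four_variables : (n < 4)%N.
Proof.
rewrite ltnNge; apply/negP => n4; have n1 : (1 < n)%N by apply: leq_trans n4.
pose i : 'I_n.+1 := ord0; pose j : 'I_n.+1 := ord_max.
have neij : i != j by rewrite -val_eqE /= eq_sym -lt0n (leq_trans _ n4).
have [b bB tb] := tangent_covered B_gen B_unit neij.
have [m [_ dm cov]] := generator_quadratic n1 bB neij tb.
have : (#|[set: 'I_n.+1]| <= #|[set i; j] :|: mon_supp m|)%N.
  apply: subset_leq_card; apply/subsetP => k _; rewrite !inE.
  have [//|neki] := eqVneq k i; have [//|nekj] := eqVneq k j.
  by have [l _ ->] := cov k neki nekj; rewrite mnmDE !mnm1E eqxx addn1.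
rewrite cardsT card_ord => le_n.
have := leq_trans le_n (leq_card_setU _ _); rewrite cards2 neij.
have := card_mon_supp m; rewrite dm => le2 lt_n.
by have := leq_trans lt_n (leq_add (leqnn 2) le2); lia.
Qed.

End GeneratorShape.

(** * Four variables *)

Section FourVariables.
Variables (K : finFieldType) (X : {set {set 'rV[K]_4}}).
Local Notation S := {mpoly K[4]}.
Variable B : seq S.
Hypothesis B_gen : eq_ideal (vanishing_ideal X) (ideal_of_seq B).
Hypothesis B_bin : forall b, b \in B -> vanishing_binomial X b.
Hypothesis B_unit : forall b i, b \in B -> b.@[unit_pt K i] = 0.
Hypothesis B_few : (size B <= 3)%N.

(** The second monomial has degree 2 and serves both [k] and [l]. *)
Lemma four_generator b (i j k l : 'I_4) : b \in B -> tangent i j b != 0 ->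
  uniq [:: i; j; k; l] -> equal_up_to_sign b ('X_i * 'X_j - 'X_k * 'X_l).
Proof.
move=> bB tb; rewrite /= !inE !negb_or => /and4P[/and3P[neij neik neil] /andP[nejk nejl] nekl _].
have [m [Db dm cov]] := generator_quadratic B_gen B_bin B_unit B_few isT bB neij tb.
have [||l' _ Dk] := cov k; [by rewrite eq_sym | by rewrite eq_sym|].
have [||k' _ Dl] := cov l; [by rewrite eq_sym | by rewrite eq_sym|].
have mk : (0 < m k)%N by rewrite Dk mnmDE [X in (_ + X)%N]mnm1E eqxx addn1.
have ml : (0 < m l)%N by rewrite Dl mnmDE [X in (_ + X)%N]mnm1E eqxx addn1.
by move: Db; rewrite (mnm_deg2 dm nekl mk ml) mpolyXD ['X_l * _]mulrC.
Qed.

Definition four_relations (t1 t2 t3 t4 : S) : seq S :=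
  [:: t1 * t2 - t3 * t4; t1 * t3 - t2 * t4; t2 * t3 - t1 * t4].

(** A generator has a nonzero derivative at the first point, so is one of the
    three relations up to sign; conversely, each relation is, up to sign, the
    generator whose differential covers its first monomial. *)
Lemma four_ideal (i1 i2 i3 i4 : 'I_4) : uniq [:: i1; i2; i3; i4] ->
  eq_ideal (vanishing_ideal X)
    (ideal_of_seq (four_relations 'X_i1 'X_i2 'X_i3 'X_i4)).
Proof.
move=> u; have all4 i : i \in [:: i1; i2; i3; i4] by apply: mem_uniq_ord.
have iI := ideal_gen_is_ideal (fun f : S => homogeneous f /\ vanishes X f).
pose G := four_relations 'X_i1 'X_i2 'X_i3 'X_i4.
have iG := ideal_gen_is_ideal (fun f => f \in G).
move: (u); rewrite /= !inE !negb_or => /and4P[/and3P[ne12 ne13 ne14] /andP[ne23 ne24] ne34 _].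
have inB b : b \in B -> vanishing_ideal X b by move=> bB; apply/B_gen/mem_ideal_gen.
have IG g : g \in G -> vanishing_ideal X g.
  have t i j k l : uniq [:: i; j; k; l] -> vanishing_ideal X ('X_i * 'X_j - 'X_k * 'X_l).
    move=> u'; have neij : i != j by move: u'; rewrite /= !inE negb_or => /andP[/andP[]].
    have [b bB tb] := tangent_covered B_gen B_unit neij.
    exact/(is_ideal_up_to_sign iI (four_generator bB tb u'))/inB.
  rewrite !inE => /or3P[] /eqP->; apply: t => //.
  - by rewrite /= !inE !negb_or ne13 ne12 ne14 eq_sym ne23 ne34 ne24.
  - by rewrite /= !inE !negb_or ne23 eq_sym ne12 ne24 eq_sym ne13 ne34 ne14.
have GB b : b \in B -> ideal_of_seq G b.
  move=> bB; have [j nej tb] := tangent_neq0 B_gen B_unit B_few i1 bB.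
  have := all4 j; rewrite !inE (eq_sym j i1) (negPf nej) /= => /or3P[] /eqP Dj; rewrite Dj in tb.
  - apply/(is_ideal_up_to_sign iG (four_generator bB tb u)).
    by apply: mem_ideal_gen; rewrite !inE eqxx.
  - have u' : uniq [:: i1; i3; i2; i4].
      by rewrite /= !inE !negb_or ne13 ne12 ne14 eq_sym ne23 ne34 ne24.
    apply/(is_ideal_up_to_sign iG (four_generator bB tb u')).
    by apply: mem_ideal_gen; rewrite !inE eqxx orbT.
  - have u' : uniq [:: i1; i4; i2; i3].
      by rewrite /= !inE !negb_or ne14 ne12 ne13 eq_sym ne24 eq_sym ne34 ne23.
    apply/(is_ideal_up_to_sign iG (four_generator bB tb u')).
    rewrite -opprB; apply: is_idealN => //.
    by apply: mem_ideal_gen; rewrite !inE eqxx !orbT.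
move=> f; split; last by apply: ideal_gen_min.
by move/B_gen; apply: ideal_gen_min.
Qed.
End FourVariables.

Lemma vanishing_ideal_eval (K : finFieldType) n (Y : {set {set 'rV[K]_n}})
    (f : {mpoly K[n]}) p (a : 'rV[K]_n) :
  vanishing_ideal Y f -> p \in Y -> a \in p -> f.@[a 0] = 0.
Proof.
move=> If pY ap; move: f If.
have iJ : is_ideal (fun f : {mpoly K[n]} => f.@[a 0] = 0).
  split=> [|f g f0 g0|h f f0]; first exact: meval0.
    by rewrite mevalD f0 g0 addr0.
  by rewrite mevalM f0 mulr0.
by move=> f; apply: (ideal_gen_min iJ) => g [_ /(_ p pY)]; apply.
Qed.

Lemma mderivU_eval1 (K : finFieldType) n (i j : 'I_n) :
  (('X_i : {mpoly K[n]})^`M(j)).@[fun=> 1] = (i == j)%:R.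
Proof.
rewrite mderivX mevalZ mevalX big1 => [|k _]; last by rewrite expr1n.
by rewrite mulr1 mnm1E.
Qed.

Section OddCardinality.
Variables (K : finFieldType) (X : {set {set 'rV[K]_4}}).
Local Notation S := {mpoly K[4]}.

(** In characteristic 2 the three relations have the same differential at the
    point [1 : 1 : 1 : 1], so they do not cut it out reducedly. Concretely,
    [t1 t2 - t2 t3] vanishes on every common zero of the relations but its
    differential at that point differs. *)
Lemma four_relations_odd (i1 i2 i3 i4 : 'I_4) : uniq [:: i1; i2; i3; i4] ->
  eq_ideal (vanishing_ideal X)
    (ideal_of_seq (four_relations 'X_i1 'X_i2 'X_i3 'X_i4)) -> odd #|K|.
Proof.
move=> u eqI; apply: contraT => q_even.
(* With #|K| even, (-1) ^+ #|K| is both -1 and 1. *)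
have two0 : 1 = -1 :> K.
  by rewrite -[RHS]expf_card -signr_odd (negPf q_even).
have vG g : g \in four_relations 'X_i1 'X_i2 'X_i3 'X_i4 ->
    forall p, p \in X -> forall a : 'rV[K]_4, a \in p -> g.@[a 0] = 0.
  move=> gG p pX a ap; apply: vanishing_ideal_eval pX ap.
  by apply/eqI; apply: mem_ideal_gen.
have If : vanishing_ideal X ('X_i1 * 'X_i2 - 'X_i2 * 'X_i3).
  apply: mem_ideal_gen; split.
    by exists 2%N; rewrite rpredB // -mpolyXD dhomogX /= mdegD !mdeg1.
  move=> p pX a ap; have ev g gG := vG g gG p pX a ap.
  have := ev ('X_i1 * 'X_i2 - 'X_i3 * 'X_i4); have := ev ('X_i2 * 'X_i3 - 'X_i1 * 'X_i4).
  rewrite !mevalB !mevalM !mevalXU !inE !eqxx !orbT => /(_ isT) e2 /(_ isT) e1.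
  set x1 := a 0 i1 in e1 e2 *; set x2 := a 0 i2 in e1 e2 *.
  set x3 := a 0 i3 in e1 e2 *; set x4 := a 0 i4 in e1 e2 *.
  have : (x1 - x3) * (x2 - x4) = 0.
    have -> : (x1 - x3) * (x2 - x4) = (x1 - x3) * (x2 - 1 * x4) by rewrite mul1r.
    rewrite two0; have -> : 0 = (x1 * x2 - x3 * x4) - (x2 * x3 - x1 * x4) by rewrite e1 e2 subr0.
    by ring.
  move/eqP; rewrite mulf_eq0 !subr_eq0 => /orP[] /eqP Dx.
    by rewrite Dx; ring.
  by rewrite -[RHS]e1 -Dx; ring.
(* Vanishing at the all-ones point makes the derivative condition in J stable
   under multiplication by arbitrary polynomials. *)
pose J (f : S) := f.@[fun=> 1] = 0 /\ (f^`M(i1)).@[fun=> 1] = (f^`M(i4)).@[fun=> 1].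
have iJ : is_ideal J.
  split=> [|f g [f0 df] [g0 dg]|h f [f0 df]].
  - by split; rewrite ?mderiv0 ?meval0.
  - by split; rewrite ?mderivD !mevalD ?f0 ?g0 ?addr0 // df dg.
  - by split; rewrite ?mderivM ?mevalD !mevalM f0 ?mulr0 // df.
move: (u); rewrite /= !inE !negb_or => /and4P[/and3P[ne12 ne13 ne14] /andP[ne23 ne24] ne34 _].
have [] : J ('X_i1 * 'X_i2 - 'X_i2 * 'X_i3).
  apply: (ideal_gen_min iJ) (proj1 (eqI _) If) => g.
  rewrite !inE => /or3P[] /eqP->; split;
    rewrite ?mderivB ?mderivM ?mevalB ?mevalD ?mevalM ?mevalXU ?mderivU_eval1
      ?mulr1 ?subrr // !(eq_sym _ i1) ?eqxx;
    rewrite ?(negPf ne12) ?(negPf ne13) ?(negPf ne14) ?(negPf ne24) ?(negPf ne34) /=;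
    by rewrite ?mulr1 ?mul1r ?mulr0 ?mul0r ?addr0 ?add0r ?subr0 ?sub0r.
rewrite !mderivB !mderivM !mevalB !mevalD !mevalM !mevalXU !mderivU_eval1.
rewrite !(eq_sym _ i1) eqxx (negPf ne12) (negPf ne13) (negPf ne14) (negPf ne24) (negPf ne34).
by rewrite ?mulr1 ?mul1r ?addr0 ?subr0 ?subrr => _ /eqP; rewrite oner_eq0.
Qed.

End OddCardinality.

(** * Three variables *)

Section ThreeVariables.
Variables (K : finFieldType) (X : {set {set 'rV[K]_3}}).
Local Notation S := {mpoly K[3]}.
Variable B : seq S.
Hypothesis B_gen : eq_ideal (vanishing_ideal X) (ideal_of_seq B).
Hypothesis B_bin : forall b, b \in B -> vanishing_binomial X b.
Hypothesis B_unit : forall b i, b \in B -> b.@[unit_pt K i] = 0.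
Hypothesis B_few : (size B <= 2)%N.

Lemma three_generator b (i j k : 'I_3) : b \in B -> tangent i j b != 0 ->
  uniq [:: i; j; k] ->
  equal_up_to_sign b ('X_i * 'X_j - 'X_i * 'X_k) \/
  equal_up_to_sign b ('X_i * 'X_j - 'X_j * 'X_k).
Proof.
move=> bB tb u; move: (u); rewrite /= !inE !negb_or => /and3P[/andP[neij neik] nejk _].
have [m [Db dm cov]] := generator_quadratic B_gen B_bin B_unit B_few isT bB neij tb.
have [||l nekl Dm] := cov k; [by rewrite eq_sym | by rewrite eq_sym|].
have := mem_uniq_ord l u erefl; rewrite !inE [l == k]eq_sym (negPf nekl) orbF.
by move: Db; rewrite Dm mpolyXD => Db /orP[]/eqP Dl; move: Db; rewrite Dl; [left|right].
Qed.

(** Each pair of variables occurs as the product covered by some generator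
    ([tangent_covered]). Hence at least two of the three differences of
    products are generators up to sign, and any two of them span the third. *)
Lemma three_ideal (i1 i2 i3 : 'I_3) : uniq [:: i1; i2; i3] ->
  eq_ideal (vanishing_ideal X)
    (ideal_of_seq [:: 'X_i1 * 'X_i2 - 'X_i2 * 'X_i3; 'X_i1 * 'X_i3 - 'X_i2 * 'X_i3]).
Proof.
move=> u; set G := [:: _; _].
have iI := ideal_gen_is_ideal (fun f : S => homogeneous f /\ vanishes X f).
have iG := ideal_gen_is_ideal (fun f => f \in G).
have inB b : b \in B -> vanishing_ideal X b by move=> bB; apply/B_gen/mem_ideal_gen.
have rel i j k : uniq [:: i; j; k] ->
    vanishing_ideal X ('X_i * 'X_j - 'X_i * 'X_k) \/
    vanishing_ideal X ('X_i * 'X_j - 'X_j * 'X_k).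
  move=> u'; have neij : i != j by move: u'; rewrite /= !inE negb_or => /andP[/andP[]].
  have [b bB tb] := tangent_covered B_gen B_unit neij.
  by case: (three_generator bB tb u') => Db; [left|right]; apply/(is_ideal_up_to_sign iI Db)/inB.
move: (u); rewrite /= !inE !negb_or => /and3P[/andP[ne12 ne13] ne23 _].
have u132 : uniq [:: i1; i3; i2] by rewrite /= !inE !negb_or ne12 ne13 eq_sym ne23.
have u231 : uniq [:: i2; i3; i1].
  by rewrite /= !inE !negb_or ne23 ![_ == i1]eq_sym ne12 ne13.
set e12 : S := 'X_i1 * 'X_i2; set e13 : S := 'X_i1 * 'X_i3; set e23 : S := 'X_i2 * 'X_i3.
have G1 : ideal_of_seq G (e12 - e23) by apply: mem_ideal_gen; rewrite !inE eqxx.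
have G2 : ideal_of_seq G (e13 - e23) by apply: mem_ideal_gen; rewrite !inE eqxx orbT.
have sG f g : ideal_of_seq G g -> f = g -> ideal_of_seq G f by move=> Gg ->.
have GB b : b \in B -> ideal_of_seq G b.
  move=> bB; have [j nej tb] := tangent_neq0 B_gen B_unit B_few i1 bB.
  have G12 : ideal_of_seq G (e12 - e13).
    by apply: sG (is_idealB iG G1 G2) _; rewrite /e12 /e13 /e23; ring.
  have := mem_uniq_ord j u erefl; rewrite !inE (eq_sym j i1) (negPf nej) /= => /orP[] /eqP Dj; rewrite Dj in tb.
    by case: (three_generator bB tb u) => Db; apply/(is_ideal_up_to_sign iG Db).
  case: (three_generator bB tb u132) => Db; apply/(is_ideal_up_to_sign iG Db).
    by apply: sG (is_idealN iG G12) _; rewrite opprB.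
  by rewrite ['X_i3 * _]mulrC.
have Itr x y z : vanishing_ideal X (x - y) -> vanishing_ideal X (y - z) ->
    vanishing_ideal X (x - z).
  by move=> Ixy Iyz; case: iI => _ /(_ _ _ Ixy Iyz); rewrite addrA subrK.
have Isym x y : vanishing_ideal X (x - y) -> vanishing_ideal X (y - x).
  by move/(is_idealN iI); rewrite opprB.
have [I1 I2] : vanishing_ideal X (e12 - e23) /\ vanishing_ideal X (e13 - e23).
  have := rel _ _ _ u; have := rel _ _ _ u132; have := rel _ _ _ u231.
  rewrite !['X_i2 * 'X_i1]mulrC !['X_i3 * 'X_i1]mulrC !['X_i3 * 'X_i2]mulrC.
  rewrite -/e12 -/e13 -/e23.
  by case=> h1; case=> h2; case=> h3; split; eauto 6.
have GI g : g \in G -> vanishing_ideal X g.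
  by rewrite !inE => /orP[] /eqP->.
move=> f; split; last by apply: ideal_gen_min.
by move/B_gen; apply: ideal_gen_min.
Qed.
End ThreeVariables.

(** * Two variables *)

Lemma dvdp_exp_sub1 (F : fieldType) (r m : nat) : (0 < r)%N ->
  ('X^r - 1 : {poly F}) %| 'X^m - 1 -> (r %| m)%N.
Proof.
move=> r0; rewrite {1}(divn_eq m r).
set k := (m %/ r)%N; set c := (m %% r)%N.
have -> : 'X^(k * r + c) - 1 = ('X^(k * r) - 1) * 'X^c + ('X^c - 1) :> {poly F}.
  by rewrite exprD; ring.
rewrite dvdp_addr; last first.
  by apply: dvdp_mulr; rewrite mulnC exprM [X in _ %| X]subrX1 dvdp_mulIl.
have [c0|c0] := posnP c; first by rewrite /dvdn -/c c0.
have nz i : (0 < i)%N -> size ('X^i - 1 : {poly F}) = i.+1 by move=> ?; rewrite size_XnsubC.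
move/dvdp_leq; rewrite !nz // ltnS => /(_ _) le_rc.
have : (r <= c)%N by apply: le_rc; rewrite -size_poly_eq0 nz.
by rewrite leqNgt ltn_mod r0.
Qed.

Section TwoVariables.
Variables (K : finFieldType) (X : {set {set 'rV[K]_2}}).
Local Notation S := {mpoly K[2]}.
Variable B : seq S.
Hypothesis B_gen : eq_ideal (vanishing_ideal X) (ideal_of_seq B).
Hypothesis B_bin : forall b, b \in B -> vanishing_binomial X b.
Hypothesis B_unit : forall b i, b \in B -> b.@[unit_pt K i] = 0.
Hypothesis B_few : (size B <= 1)%N.

(** Dehomogenize the membership of [X_i^q X_j - X_i X_j^q] by [X_j = 1] and
    compare the exponents of [X^(q-1) - 1] and [X^r - 1]. *)
Lemma frob_dvd (i j : 'I_2) (r : nat) : i != j -> (0 < r)%N ->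
  eq_ideal (vanishing_ideal X)
    (ideal_of_seq [:: 'X_i ^+ r.+1 * 'X_j - 'X_i * 'X_j ^+ r.+1]) ->
  (r %| #|K| - 1)%N.
Proof.
move=> neij r0 eqI.
have /eqI/ideal_of_seqP[h] := frob_binomial_vanishing X i j.
rewrite big_ord1 /= => Dh.
pose phi : {rmorphism S -> {poly K}} :=
  mmap (polyC : {rmorphism K -> {poly K}}) (fun k => if k == i then 'X else 1).
have phiU k : phi 'X_k = if k == i then 'X else 1 by rewrite /phi /= mmapX mmap1U.
have phij : phi 'X_j = 1 by rewrite phiU eq_sym (negPf neij).
have phii : phi 'X_i = 'X by rewrite phiU eqxx.
have := congr1 phi Dh; rewrite /frob_binomial !(rmorphB, rmorphM, rmorphXn) phij phii.
have q1 : (0 < #|K|)%N by apply: ltnW (card_finNzRing_gt1 K).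
rewrite !expr1n !mulr1 -{1}(subnK q1) addn1 !exprS => E.
apply: (@dvdp_exp_sub1 K) => //; apply/dvdpP; exists (phi (h ord0)).
have X0 : 'X != 0 :> {poly K} by rewrite polyX_eq0.
apply: (mulfI X0); rewrite mulrBr mulr1 E; ring.
Qed.

(** The single generator has two monomials serving one coordinate point each.
    In degree 2 both would be [X_i X_j]. *)
Lemma two_ideal (i j : 'I_2) : i != j -> exists r : nat,
  [/\ r != 0%N, (r %| #|K| - 1)%N &
    eq_ideal (vanishing_ideal X)
     (ideal_of_seq [:: 'X_i ^+ r.+1 * 'X_j - 'X_i * 'X_j ^+ r.+1])].
Proof.
move=> neij; have ij k : (k == i) || (k == j).
  by case: i j k neij => [[|[|//]] ?] [[|[|//]] ?] [[|[|//]] ?].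
have [b bB tb] := tangent_covered B_gen B_unit neij.
have [d [m [Db [d1 dm ne_m] pure cov]]] := generator_shape B_gen B_bin B_unit B_few bB neij tb.
have deg_m : (m i + m j)%N = d.
  rewrite -dm mdegE (bigD1 i) //= (bigD1 j) 1?eq_sym //= big1 ?addn0 //.
  by move=> k /andP[ki kj]; have := ij k; rewrite (negPf ki) (negPf kj).
have eq_m (m' : 'X_{1..2}) : m i = m' i -> m j = m' j -> m = m'.
  by move=> Ei Ej; apply/mnmP => k; case/orP: (ij k) => /eqP->.
have neji : j == i = false by rewrite eq_sym (negPf neij).
have d2 : (2 < d)%N.
  rewrite ltn_neqAle d1 andbT; apply/eqP => Dd.
  have [mi|mi] := posnP (m i).
    case/eqP: (pure j); apply: eq_m; rewrite mulmnE mnm1E ?neji ?eqxx; lia.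
  have [mj|mj] := posnP (m j).
    case/eqP: (pure i); apply: eq_m; rewrite mulmnE mnm1E ?(negPf neij) ?eqxx; lia.
  by case/eqP: ne_m; rewrite -Dd tangent_mnm_deg2; apply: mnm_deg2; rewrite ?dm.
have Dm : m = tangent_mnm j i d.
  have [l nejl] := cov j; have /orP[/eqP->|/eqP Dl] := ij l; last by rewrite Dl eqxx in nejl.
  by case=> // /(tangent_mnm_inj d2) Eij; rewrite Eij eqxx in neij.
exists d.-2; have r0 : (0 < d.-2)%N by lia.
pose g : S := 'X_i ^+ d.-2.+1 * 'X_j - 'X_i * 'X_j ^+ d.-2.+1.
have Dg : equal_up_to_sign b g.
  move: Db; rewrite Dm /tangent_mnm !mpolyXD -!mpolyXn.
  by rewrite /g (_ : d.-2.+1 = d.-1) 1?['X_j * _]mulrC //; lia.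
have DB : B = [:: b].
  case: (B) B_few bB => [//|x [|//]] _; rewrite inE => /eqP->; by [].
have eqI : eq_ideal (vanishing_ideal X) (ideal_of_seq [:: g]).
  move=> f; split=> [/B_gen|].
    rewrite DB; apply: ideal_of_seq_sub => x; rewrite inE => /eqP->.
    apply/(is_ideal_up_to_sign (ideal_gen_is_ideal _) Dg).
    by apply: mem_ideal_gen; rewrite inE.
  move=> gf; apply/B_gen; move: gf; apply: ideal_of_seq_sub => x; rewrite inE => /eqP->.
  apply/(is_ideal_up_to_sign (ideal_gen_is_ideal _) Dg).
  by apply: mem_ideal_gen.
split=> //; first by rewrite -lt0n.
exact: frob_dvd eqI.
Qed.
End TwoVariables.

(** * The classification *)

(** The binomials among which the generators are expressed are homogeneous, so
    superfluous ones can be discarded until there are no more of them than [gs]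
    has elements. *)
Lemma ideal_gens_binomial (K : finFieldType) (n s : nat)
    (v : 'I_s.+1 -> 'X_{1..n}) (gs : seq {mpoly K[s.+1]}) :
  let I := vanishing_ideal (param_set K v) in
  eq_ideal I (ideal_of_seq gs) ->
  exists B : seq {mpoly K[s.+1]},
    [/\ (size B <= size gs)%N, eq_ideal I (ideal_of_seq B) &
        forall b, b \in B -> vanishing_binomial (param_set K v) b].
Proof.
move=> I eqI.
have Ibin b : vanishing_binomial (param_set K v) b -> homogeneous b /\ I b.
  case=> m1 [m2 [eqd -> vb]]; have hb : homogeneous ('X_[m1] - 'X_[m2] : {mpoly K[s.+1]}).
    by exists (mdeg m1); rewrite rpredB // dhomogX //= eqd.
  by split=> //; apply: mem_ideal_gen.
have [|B0 [bin0 gs0]] := @ideal_gen_finite _ (vanishing_binomial (param_set K v)) gs.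
  by move=> g ggs; apply/vanishing_ideal_binomial/eqI/mem_ideal_gen.
have [|||B [subB szB gsB]] := @few_generators K s.+1 B0 gs.
- by move=> b /bin0/Ibin[].
- by move=> b /bin0/Ibin[_ /eqI].
- exact: gs0.
have binB b : b \in B -> vanishing_binomial (param_set K v) b by move/subB/bin0.
exists B; split=> // f; split=> [/eqI|]; first exact: ideal_of_seq_sub.
by apply: ideal_gen_min; [exact: ideal_gen_is_ideal | move=> b /binB/Ibin[]].
Qed.

Lemma perm_var1 (K : finFieldType) s (k : nat) (ltk : (k < s)%N) :
  perm_var K (1%g : 'S_s) k.+1 = 'X_(Ordinal ltk).
Proof.
rewrite /perm_var /= (nth_map (Ordinal ltk)) ?size_enum_ord // perm1.
by congr 'X_ _; apply: val_inj; rewrite /= nth_enum_ord.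
Qed.

Theorem theorem2p19 (K : finFieldType) (n s : nat) (hs : (0 < s)%N)
    (v : 'I_s -> 'X_{1..n})
    (hv : forall i j : 'I_s, i != j ->
            ~~ (mon_supp (v i) \subset mon_supp (v j))) :
  let q := #|K| in
  let I := vanishing_ideal (param_set K v) in
  complete_intersection I <->
  (s <= 4)%N /\
  exists sigma : 'S_s,
    let t1 := perm_var K sigma 1 in
    let t2 := perm_var K sigma 2 in
    let t3 := perm_var K sigma 3 in
    let t4 := perm_var K sigma 4 in
    [\/ [/\ s = 4%N, odd q &
          eq_ideal I (ideal_of_seq [:: t1 * t2 - t3 * t4;
                                       t1 * t3 - t2 * t4;
                                       t2 * t3 - t1 * t4])],
        s = 3%N /\
          eq_ideal I (ideal_of_seq [:: t1 * t2 - t2 * t3;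
                                       t1 * t3 - t2 * t3]),
        s = 2%N /\
          exists r : nat, [/\ r != 0%N, (r %| q - 1)%N &
            eq_ideal I (ideal_of_seq [:: t1 ^+ r.+1 * t2 - t1 * t2 ^+ r.+1])] |
        s = 1%N /\ eq_ideal I (ideal_of_seq [:: 0])].
Proof.
move=> q I; case: s hs v hv @I => // s _ v hv I.
have htI : ideal_height I s.
  by apply: height_vanishing_ideal; [exact: param_set_points | exact: param_set_neq0].
split=> [[gs [htgs eqI]] | [_ [sigma forms]]]; last first.
  have nil0 (f : {mpoly K[s.+1]}) : ideal_of_seq [:: 0] f <-> ideal_of_seq [::] f :> Prop.
    split; apply: ideal_of_seq_sub => // g; rewrite inE => /eqP->.
    by have [J0 _ _] := ideal_gen_is_ideal (fun g : {mpoly K[s.+1]} => g \in [::]); exact: J0.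
  have ci gs : size gs = s -> eq_ideal I (ideal_of_seq gs) -> complete_intersection I.
    by move=> szgs eqI; exists gs; rewrite szgs.
  case: forms => [[[Ds] _ eqI]|[[Ds] eqI]|[[Ds] [r [_ _ eqI]]]|[[Ds] eqI]].
  - exact: ci eqI.
  - exact: ci eqI.
  - exact: ci eqI.
  apply: (ci [::]); first exact/esym.
  by move=> f; split=> [/eqI/nil0|/nil0/eqI].
(* The number of generators is a minimum of heights of primes containing I, one
   of which is s. *)
have le_gs : (size gs <= s)%N.
  by case: htI => [[P [PI hP]] _]; case: htgs => _; apply; [exact: PI | exact: hP].
have [B [szB genB binB]] := ideal_gens_binomial eqI.
have {le_gs szB} B_few : (size B <= s)%N by apply: leq_trans szB le_gs.
have B_unit b i : b \in B -> b.@[unit_pt K i] = 0.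
  case/binB => m1 [m2 [eqd Db vb]]; apply: (vanishes_unit_point hv) vb.
  by exists (mdeg m1); rewrite Db rpredB // dhomogX //= eqd.
have s4 := at_most_four_variables genB binB B_unit B_few.
(* Each listed ideal is invariant under renaming, so the identity serves. *)
split=> //; exists 1%g; rewrite /q.
have [|||] : [\/ s = 0, s = 1, s = 2 | s = 3]%N by case: (s) s4 => [|[|[|[]]]]; constructor.
- move=> Ds; subst s; apply: Or44; split; first by [].
  move=> f; split=> [/genB|].
    by move: B_few; rewrite leqn0 => /nilP->; apply: ideal_of_seq_sub.
  move=> f0; apply/genB; move: f0; apply: ideal_of_seq_sub => g; rewrite inE => /eqP->.
  by have [J0 _ _] := ideal_gen_is_ideal (fun g : {mpoly K[1]} => g \in B); exact: J0.
- move=> Ds; subst s; apply: Or43; split; first by [].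
  rewrite (perm_var1 K (isT : 0 < 2)%N) (perm_var1 K (isT : 1 < 2)%N).
  have neq : Ordinal (isT : 0 < 2)%N != Ordinal (isT : 1 < 2)%N by [].
  have [r [r0 rq eqr]] := two_ideal genB binB B_unit B_few neq.
  by exists r.
- move=> Ds; subst s; apply: Or42; split; first by [].
  rewrite (perm_var1 K (isT : 0 < 3)%N) (perm_var1 K (isT : 1 < 3)%N).
  rewrite (perm_var1 K (isT : 2 < 3)%N).
  have u : uniq [:: Ordinal (isT : 0 < 3)%N; Ordinal (isT : 1 < 3)%N;
                    Ordinal (isT : 2 < 3)%N] by [].
  exact: (three_ideal genB binB B_unit B_few u).
move=> Ds; subst s; apply: Or41.
rewrite (perm_var1 K (isT : 0 < 4)%N) (perm_var1 K (isT : 1 < 4)%N).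
rewrite (perm_var1 K (isT : 2 < 4)%N) (perm_var1 K (isT : 3 < 4)%N).
have u : uniq [:: Ordinal (isT : 0 < 4)%N; Ordinal (isT : 1 < 4)%N;
                  Ordinal (isT : 2 < 4)%N; Ordinal (isT : 3 < 4)%N] by [].
have eqF := four_ideal genB binB B_unit B_few u.
by split; [| exact: (four_relations_odd u eqF) | exact: eqF].
Qed.
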